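(* Let $(M,\omega)$ be a connected symplectic Fréchet manifold endowed with a symplectic action of a Fréchet Lie group $G$ with Lie algebra $\mathfrak g$. Assume that the action has a momentum map $J:M\to\mathfrak g$ relative to a non-degenerate symmetric pairing $\kappa:\mathfrak g\times\mathfrak g\to\mathbb R$. Let $m\in M$ be a critical point of $\|J\|^2_\kappa$, $\|J\|_\kappa^2(x)=\kappa(J(x),J(x))$. In infinite dimensions, assume the following (which always hold in finite dimensions): (1) $G$ has a smooth exponential map; (2) the stabilizer $G_m$ is a Lie subgroup of $G$; (3) the isotropy representation of $\mathfrak g_m$ on $T_mM$ has a momentum map $\hat J:T_mM\to\mathfrak g_m$. Then the Hessian of $\|J\|_\kappa^2$ at $m$ is given by $$\tfrac12\operatorname{Hess}_m\|J\|_\kappa^2(X)=\|T_mJ(X)\|_\kappa^2+2\,\kappa\bigl(\hat J(X),J(m)\bigr),\qquad X\in T_mM,$$ and the associated symmetric bilinear form is given by $$\tfrac12\operatorname{Hess}_m\|J\|_\kappa^2(X,Y)=\kappa\bigl(T_mJ(X),T_mJ(Y)\bigr)+\omega_m\bigl(X,\tau_m(J(m)^* )\,Y\bigr),\qquad X,Y\in T_mM.$$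
   Context: Symplectic forms are weak: $\omega$ is closed and $X\mapsto\omega_m(X,\cdot)$ is injective. $\Upsilon_g:M\to M$ is the action of $g\in G$ (a left action); $\xi\cdot m=\xi^*(m)=\frac{d}{dt}|_{t=0}\Upsilon_{\exp(t\xi)}(m)$, and $\mathfrak g_m=\{\xi:\xi\cdot m=0\}$. A momentum map $J:M\to\mathfrak g$ relative to $\kappa$ satisfies $\omega_m(\xi\cdot m,X)+\kappa(T_mJ(X),\xi)=0$ for all $m\in M$, $X\in T_mM$, $\xi\in\mathfrak g$; equivariance of $J$ and invariance of $\kappa$ are not assumed. $\|\xi\|_\kappa^2=\kappa(\xi,\xi)$. The point $m$ is critical if and only if $J(m)\in\mathfrak g_m$. For $\sigma\in\mathfrak g_m$, the linearization of the fundamental vector field at $m$ is $\tau_m\sigma^*:T_mM\to T_mM$, $\tau_m\sigma^*(X)=\frac{d}{dt}|_{t=0}T_m\Upsilon_{\exp(t\sigma)}(X)$; this is the isotropy representation of $\mathfrak g_m$. Its momentum map $\hat J:T_mM\to\mathfrak g_m$ is defined by $\kappa(\hat J(X),\sigma)=\frac12\omega_m(X,\tau_m\sigma^*(X))$ for all $\sigma\in\mathfrak g_m$ (assumption (3) says such $\hat J(X)\in\mathfrak g_m$ exists for each $X$). The Hessian of $f:M\to\mathbb R$ at a critical point $m$ is the quadratic form $\operatorname{Hess}_mf(X)=\frac{d^2}{dt^2}|_{t=0}f(\gamma(t))$ for any smooth curve $\gamma$ with $\gamma(0)=m$, $\dot\gamma(0)=X$; $\operatorname{Hess}_mf(X,Y)$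 denotes its polarization.
   Formalization: Assumptions (1)–(3) are made in every dimension: (3) can fail in finite dimensions when κ restricted to 𝔤_m is degenerate, and then Ĵ is undefined; the pairing κ is taken to be continuous. *)

(* Defs.v *)
From HB Require Import structures.
From mathcomp Require Import all_boot all_order all_algebra.
From mathcomp Require Import all_classical all_reals all_analysis.

Set Implicit Arguments.
Unset Strict Implicit.
Unset Printing Implicit Defensive.

Import Order.TTheory GRing.Theory Num.Theory.
Import numFieldNormedType.Exports.

Local Open Scope classical_set_scope.
Local Open Scope ring_scope.

(* [tvsType] is the library's type of locally convex spaces.  Its uniform
   structure is compatible with the topology but is not required to be
   translation invariant, so metrizability and completeness are stated with
   neighbourhoods of 0, i.e. for the canonical uniformity of the vector
   topology. *)
HB.mixin Record Tvs_isFrechet (R : realType) E & Tvs R E := {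
  frechet_hausdorff : hausdorff_space E;
  frechet_countable_base : exists B : nat -> set E,
    (forall n, nbhs (0 : E) (B n)) /\
    (forall U, nbhs (0 : E) U -> exists n, B n `<=` U);
  frechet_complete : forall u : nat -> E,
    (forall U, nbhs (0 : E) U -> exists N, forall i j,
       (N <= i)%N -> (N <= j)%N -> U (u i - u j)) ->
    exists l : E, u @ \oo --> l
}.

#[short(type="frechetType")]
HB.structure Definition Frechet (R : realType) :=
  {E of Tvs_isFrechet R E & Tvs R E}.

Section RealFrechet.
Context (R : realType).

Lemma real_hausdorff : hausdorff_space R^o.
Proof. exact: (@norm_hausdorff R R^o). Qed.

Lemma real_countable_base : exists B : nat -> set R^o,
  (forall n, nbhs (0 : R^o) (B n)) /\
  (forall U, nbhs (0 : R^o) U -> exists n, B n `<=` U).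
Proof.
exists (fun n => ball (0 : R^o) n.+1%:R^-1); split.
  by move=> n; apply: nbhsx_ballx; rewrite invr_gt0 ltr0n.
move=> U /nbhs_ballP[e /= e0 eU].
have [n /andP[_ ne]] : exists n : nat, true && (n.+1%:R^-1 < e).
  exists (Num.truncn e^-1); rewrite /= -[ltRHS]invrK ltf_pV2 ?posrE ?ltr0n ?invr_gt0//.
  by rewrite truncnS_gt.
by exists n => x xn; apply: eU; apply: le_ball xn; exact: ltW.
Qed.

Lemma real_complete (u : nat -> R^o) :
  (forall U, nbhs (0 : R^o) U -> exists N, forall i j,
     (N <= i)%N -> (N <= j)%N -> U (u i - u j)) ->
  exists l : R^o, u @ \oo --> l.
Proof.
move=> uC; apply/cvg_ex/cauchy_cvgP; apply/cauchy_ballP => e e0.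
have [N uN] := uC _ (nbhsx_ballx (0 : R^o) e e0).
exists (u @` [set i | (N <= i)%N], u @` [set i | (N <= i)%N]).
  by split => /=; exists N => // i /= Ni; exists i.
move=> [_ _] [/= [i /= Ni <-] [j /= Nj <-]].
have := uN j i Nj Ni.
by rewrite -!ball_normE /= sub0r normrN distrC.
Qed.

HB.instance Definition _ := Tvs_isFrechet.Build R R^o
  real_hausdorff real_countable_base real_complete.

End RealFrechet.

Section Calculus.
Context {R : realType}.

(* The library's ['D_v f x] and [derivable] are restricted to normed spaces;
   these are the same notions for topological vector spaces, with value 0 where
   the derivative does not exist. *)
Definition tvs_is_derive {E F : tvsType R} (f : E -> F) (x v : E) (l : F) :
    Prop :=
  (fun h : R => h^-1 *: (f (h *: v + x) - f x)) @ 0^' --> l.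

Definition tvs_derive {E F : tvsType R} (f : E -> F) (x v : E) : F :=
  xget 0 [set l | tvs_is_derive f x v l].

(* C^k on an open set in the sense of Michal-Bastiani: f is C^(k+1) when it is
   continuous, all directional derivatives exist, and (x, v) |-> Df(x)v is C^k
   as a map on U x E. *)
Fixpoint class_C (k : nat) (E F : tvsType R) (U : set E) (f : E -> F) : Prop :=
  (forall x, U x -> {for x, continuous f}) /\
  match k with
  | 0%N => True
  | k'.+1 => (forall x v, U x -> exists l, tvs_is_derive f x v l) /\
      @class_C k' (E * E)%type F (U `*` setT)
        (fun z : E * E => tvs_derive f z.1 z.2)
  end.

Definition smooth_on {E F : tvsType R} (U : set E) (f : E -> F) : Prop :=
  open U /\ forall k, class_C k U f.

Lemma linear_is_derive (E F : tvsType R) (L : E -> F) (x v : E) :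
  linear L -> tvs_is_derive L x v (L v).
Proof.
move=> linL; apply: cvg_near_cst; near=> h.
rewrite linL addrK scalerA mulVf ?scale1r//.
by near: h; exact: nbhs_dnbhs_neq.
Unshelve. all: by end_near. Qed.

Lemma tvs_derive_val (E : tvsType R) (F : frechetType R) (f : E -> F)
    (x v : E) (l : F) : tvs_is_derive f x v l -> tvs_derive f x v = l.
Proof.
move=> fl; apply: xget_unique => // l' fl'.
exact: (cvg_unique (@frechet_hausdorff R F)) fl' fl.
Qed.

Lemma linear_class_C k (E : tvsType R) (F : frechetType R) (U : set E)
    (L : E -> F) : linear L -> continuous L -> class_C k U L.
Proof.
elim: k E U L => [|k IH] E U L linL cL; first by split=> // x _; exact: cL.
split; first by move=> x _; exact: cL.
split; first by move=> x v _; exists (L v); exact: linear_is_derive.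
rewrite (_ : (fun z : E * E => _) = L \o snd); last first.
  by apply/funext => z; apply: tvs_derive_val; exact: linear_is_derive.
apply: IH; first by move=> a z w /=; rewrite linL.
by move=> z; apply: continuous_comp; [exact: cvg_snd | exact: cL].
Qed.

Lemma affine_continuous (E' E : tvsType R) (L : E' -> E) (a : E) :
  continuous L -> continuous (fun z => L z + a).
Proof.
move=> cL z; apply: (@continuous_comp _ _ _ (fun z => (L z, a))
  (fun w : E * E => w.1 + w.2)); last exact: add_continuous.
by apply: cvg_pair => /=; [exact: cL | exact: cvg_cst].
Qed.

Lemma scale_vector_continuous (E : tvsType R) (v : E) :
  continuous (fun t : R^o => t *: v).
Proof.
move=> t; apply: (@continuous_comp _ _ _ (fun t : R^o => (t, v))
  (fun z : R^o * E => z.1 *: z.2)); last exact: scale_continuous.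
have Hpair : (fun t : R^o => (t, v)) @ t --> (t, v).
  have h := @cvg_pair R^o R^o E (nbhs t) (nbhs t) (nbhs v) _ _ _ id (fun=> v).
  exact: h cvg_id (cvg_cst v).
exact: Hpair.
Qed.

Lemma class_C_affine k (E' E F : tvsType R) (V : set E) (f : E -> F)
    (L : E' -> E) (a : E) :
  linear L -> continuous L -> class_C k V f ->
  class_C k [set z | V (L z + a)] (fun z => f (L z + a)).
Proof.
move=> linL cL.
have contA (D' D F' : tvsType R) (W : set D) (g : D -> F') (K : D' -> D) (b : D) :
    continuous K -> (forall x, W x -> {for x, continuous g}) ->
    forall z, W (K z + b) -> {for z, continuous (fun z => g (K z + b))}.
  move=> cK cg z Wz; apply: (@continuous_comp _ _ _ (fun z => K z + b) g).
    exact: affine_continuous.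
  exact: cg.
elim: k E' E V f L a linL cL => [|k IH] E' E V f L a linL cL.
  by case=> cf _; split=> //; exact: contA.
case=> cf [df dfC]; split; first exact: contA.
have quot (z v : E') :
    (fun h : R => h^-1 *: (f (L (h *: v + z) + a) - f (L z + a))) =
    (fun h : R => h^-1 *: (f (h *: L v + (L z + a)) - f (L z + a))).
  by apply/funext => h; rewrite linL addrA.
split.
  move=> z v Vz; have [l fl] := df _ (L v) Vz.
  by exists l; rewrite /tvs_is_derive quot.
pose L2 (z : E' * E') := (L z.1, L z.2).
have linL2 : linear L2 by move=> t z w; rewrite /L2 /= !linL.
have cL2 : continuous L2.
  move=> z; apply: cvg_pair => /=.
    by apply: (@continuous_comp _ _ _ fst L); [exact: cvg_fst | exact: cL].
  by apply: (@continuous_comp _ _ _ snd L); [exact: cvg_snd | exact: cL].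
have := IH _ _ _ _ L2 (a, 0) linL2 cL2 dfC.
rewrite (_ : [set z | _] = [set z | V (L z + a)] `*` setT); last first.
  by apply/seteqP; split => -[z v] /=; case.
rewrite (_ : (fun z => _) = fun z : E' * E' =>
    tvs_derive (fun z => f (L z + a)) z.1 z.2) //.
apply/funext => -[z v] /=.
by rewrite /tvs_derive /tvs_is_derive /= quot addr0.
Qed.

Lemma smooth_on_id (E : frechetType R) : smooth_on setT (@id E).
Proof.
split; first exact: openT.
by move=> k; apply: linear_class_C => // x; exact: cvg_id.
Qed.

Definition bilinear_form (E : lmodType R) (b : E -> E -> R) : Prop :=
  (forall y, scalar (b ^~ y)) /\ (forall x, scalar (b x)).

(* The symmetric bilinear form associated with a quadratic form. *)
Definition polarization (E : lmodType R) (Q : E -> R) (X Y : E) : R :=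
  2^-1 * (Q (X + Y) - Q X - Q Y).

End Calculus.

Record chart {R : realType} (M : topologicalType) (E : tvsType R) := Chart {
  chart_dom : set M;
  chart_map :> M -> E;
  chart_inv : E -> M;
  chart_dom_open : open chart_dom;
  chart_cod_open : open (chart_map @` chart_dom);
  chart_mapK : forall p, chart_dom p -> chart_inv (chart_map p) = p;
  chart_map_continuous : forall p, chart_dom p -> {for p, continuous chart_map};
  chart_inv_continuous : forall x, (chart_map @` chart_dom) x ->
    {for x, continuous chart_inv}
}.

Section Charts.
Context {R : realType} {M : topologicalType} {E : tvsType R}.
Implicit Types c d : chart M E.

Definition chart_cod c : set E := c @` chart_dom c.

Definition smooth_transition c d : Prop :=
  smooth_on (c @` (chart_dom c `&` chart_dom d)) (d \o chart_inv c).

End Charts.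

(* [chart_at p] is a preferred chart around p; it serves to identify the
   tangent space at p with the model space. *)
Record frechetManifold (R : realType) := FrechetManifold {
  carrier :> topologicalType;
  model : frechetType R;
  atlas : set (chart carrier model);
  chart_at : carrier -> chart carrier model;
  manifold_hausdorff : hausdorff_space carrier;
  atlas_smooth : forall c d, atlas c -> atlas d -> smooth_transition c d;
  chart_at_atlas : forall p, atlas (chart_at p);
  chart_at_dom : forall p, chart_dom (chart_at p) p
}.

Section FlatManifold.
Context {R : realType} (E : frechetType R).

Lemma open_id_image : open ((@id E) @` setT).
Proof. by rewrite image_id; exact: openT. Qed.

Definition id_chart : chart E E :=
  @Chart R E E setT id id openT open_id_image (fun _ _ => erefl)
    (fun p _ => @cvg_id _ (nbhs p)) (fun p _ => @cvg_id _ (nbhs p)).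

Lemma id_chart_transition (c d : chart E E) :
  c = id_chart -> d = id_chart -> smooth_transition c d.
Proof.
move=> -> ->; rewrite /smooth_transition /= setTI image_id.
exact: smooth_on_id.
Qed.

(* A Frechet space as a manifold, with the identity as only chart. *)
Definition flat_manifold : frechetManifold R :=
  @FrechetManifold R E E [set id_chart] (fun _ => id_chart)
    (@frechet_hausdorff R E) id_chart_transition
    (fun _ => erefl) (fun _ => Logic.I).

End FlatManifold.

Section TangentSpaces.
Context {R : realType}.
Implicit Types M N P : frechetManifold R.

(* A vector X of [tangent p] stands for the tangent vector at p with coordinate
   vector X in the chart [chart_at p]. *)
Definition tangent M (p : M) : frechetType R := model M.

Definition smooth_map_on M N (U : set M) (f : M -> N) : Prop :=
  [/\ open U,
      forall p, U p -> {for p, continuous f} &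
      forall c d, atlas c -> atlas d ->
        smooth_on [set x | [/\ chart_cod c x, U (chart_inv c x) &
                               chart_dom d (f (chart_inv c x))]]
                  (d \o f \o chart_inv c)].

Definition smooth_map M N (f : M -> N) : Prop := smooth_map_on setT f.

(* Smoothness on the product manifold M x N, whose charts are the products of
   charts of M and N. *)
Definition smooth_map2 M N P (f : M -> N -> P) : Prop :=
  continuous (fun z : M * N => f z.1 z.2) /\
  forall (c : chart M (model M)) (d : chart N (model N)) (e : chart P (model P)),
    atlas c -> atlas d -> atlas e ->
    smooth_on [set z : model M * model N |
                [/\ chart_cod c z.1, chart_cod d z.2 &
                    chart_dom e (f (chart_inv c z.1) (chart_inv d z.2))]]
              (fun z : model M * model N =>
                e (f (chart_inv c z.1) (chart_inv d z.2))).

Definition tangent_map M N (f : M -> N) (p : M) (X : tangent p) :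
    tangent (f p) :=
  tvs_derive (chart_at (f p) \o f \o chart_inv (chart_at p)) (chart_at p p) X.

Definition real_line : frechetManifold R := flat_manifold R^o.

Definition smooth_curve_at0 M (gamma : R -> M) : Prop :=
  exists2 U : set real_line, U 0 & smooth_map_on U (gamma : real_line -> M).

Definition velocity M (gamma : R -> M) : tangent (gamma 0) :=
  @tangent_map real_line M gamma 0 (1 : R).

Definition critical_point M (f : M -> R) (p : M) : Prop :=
  forall X : tangent p, @tangent_map M real_line f p X = 0.

Definition is_hessian M (f : M -> R) (p : M) (Q : tangent p -> R) : Prop :=
  forall (X : tangent p) (gamma : R -> M),
    smooth_curve_at0 gamma -> gamma 0 = p -> velocity gamma = X ->
    (\forall t \near (0 : R), derivable (f \o gamma : R^o -> R^o) t 1) /\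
    is_derive (0 : R^o) (1 : R^o) (derive1 (f \o gamma : R -> R^o)) (Q X).

Lemma smooth_curve_through M (p : M) (X : tangent p) :
  exists gamma : R -> M,
    [/\ smooth_curve_at0 gamma, gamma 0 = p & velocity gamma = X].
Proof.
pose c := chart_at p; pose x := c p.
pose L (t : R^o) : model M := t *: (X : model M).
have linL : linear L by move=> a s t; rewrite /L scalerDl scalerA.
have cL : continuous L by exact: scale_vector_continuous.
pose gamma (t : R) : M := chart_inv c (L t + x).
have gamma0 : gamma 0 = p.
  by rewrite /gamma /L scale0r add0r chart_mapK//; exact: chart_at_dom.
have cA : continuous (fun t => L t + x) by exact: affine_continuous.
pose U : set R^o := (fun t : R^o => L t + x) @^-1` chart_cod c.
have oU : open U.
  by apply: open_comp; [move=> t _; exact: cA | exact: chart_cod_open].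
have U0 : U 0.
  by rewrite /U /= /L scale0r add0r; exists p => //; exact: chart_at_dom.
have mapK t : U t -> c (gamma t) = L t + x.
  by case=> q qc qE; rewrite /gamma -qE chart_mapK.
exists gamma; split => //.
  exists U => //; split => //.
    move=> t Ut; apply: (@continuous_comp _ _ _ (fun t : R^o => L t + x)
      (chart_inv c)); first exact: cA.
    exact: chart_inv_continuous.
  move=> e d -> dM; have [oV fC] := atlas_smooth (chart_at_atlas p) dM.
  have -> : [set t : R^o | [/\ chart_cod (id_chart R^o) t,
      U (chart_inv (id_chart R^o) t) &
      chart_dom d (gamma (chart_inv (id_chart R^o) t))]] =
    [set t | (c @` (chart_dom c `&` chart_dom d)) (L t + x)].
    apply/seteqP; split => t /=.
      case=> _ [q qc qE]; rewrite /gamma -qE chart_mapK// => qd.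
      by exists q.
    case=> q [qc qd] qE; split; first by exists t.
      by exists q.
    by rewrite /gamma -qE chart_mapK.
  split; first by apply: open_comp => // t _; exact: cA.
  by move=> k; exact: (class_C_affine x linL cL (fC k)).
rewrite /velocity /tangent_map; apply: tvs_derive_val.
apply: cvg_near_cst; near=> h.
rewrite /= gamma0 -/c.
have -> : h *: (1 : R^o) + 0 = h :> R^o by rewrite addr0 [h *: _]mulr1.
rewrite mapK//; last by near: h; apply: nbhs_dnbhs; exact: open_nbhs_nbhs.
rewrite /x addrK /L scalerA mulVf ?scale1r//.
by near: h; exact: nbhs_dnbhs_neq.
Unshelve. all: by end_near. Qed.

Lemma is_hessian_unique M (f : M -> R) (p : M) (Q Q' : tangent p -> R) :
  is_hessian f Q -> is_hessian f Q' -> Q = Q'.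
Proof.
move=> fQ fQ'; apply/funext => X.
have [gamma [sg g0 gX]] := smooth_curve_through X.
have [_ [_ <-]] := fQ X _ sg g0 gX.
by have [_ [_ <-]] := fQ' X _ sg g0 gX.
Qed.

Definition compatible_chart M (c : chart M (model M)) : Prop :=
  forall d, atlas d -> smooth_transition c d /\ smooth_transition d c.

(* Submanifolds (hence Lie subgroups) need not be split: the closed subspace F is
   not required to have a topological complement. *)
Definition is_submanifold M (S : set M) : Prop :=
  exists F : set (model M),
    [/\ closed F, F 0, (forall (a : R) x y, F x -> F y -> F (a *: x + y)) &
        forall p, S p -> exists c : chart M (model M),
          [/\ compatible_chart c, chart_dom c p &
              c @` (chart_dom c `&` S) = chart_cod c `&` F]].

End TangentSpaces.

Section TwoForms.
Context {R : realType} {M : frechetManifold R}.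
Implicit Types omega : forall p : M, tangent p -> tangent p -> R.

(* The tangent vector at [chart_inv c x] with coordinate vector v in chart c. *)
Definition chart_vector (c : chart M (model M)) (x v : model M) :
    tangent (chart_inv c x) :=
  tvs_derive (chart_at (chart_inv c x) \o chart_inv c) x v.

Definition form_in_chart omega (c : chart M (model M)) (x u v : model M) : R :=
  omega (chart_inv c x) (chart_vector c x u) (chart_vector c x v).

Definition smooth_form omega : Prop := forall c, atlas c ->
  smooth_on ((chart_cod c `*` setT) `*` setT)
    (fun z : (model M * model M) * model M =>
       form_in_chart omega c z.1.1 z.1.2 z.2 : R^o).

(* d(omega)(u, v, w) evaluated on coordinate (constant) vector fields. *)
Definition closed_form omega : Prop := forall c, atlas c ->
  forall x, chart_cod c x -> forall u v w : model M,
    tvs_derive (fun y => form_in_chart omega c y v w : R^o) x u +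
    tvs_derive (fun y => form_in_chart omega c y w u : R^o) x v +
    tvs_derive (fun y => form_in_chart omega c y u v : R^o) x w = 0.

Definition symplectic_form omega : Prop :=
  [/\ smooth_form omega,
      forall p, bilinear_form (omega p),
      forall p (X : tangent p), omega p X X = 0,
      closed_form omega &
      forall p (X : tangent p), (forall Y, omega p X Y = 0) -> X = 0].

End TwoForms.

Record lieGroup (R : realType) := LieGroup {
  lie_manifold :> frechetManifold R;
  lie_mul : lie_manifold -> lie_manifold -> lie_manifold;
  lie_one : lie_manifold;
  lie_inv : lie_manifold -> lie_manifold;
  lie_mulA : forall x y z, lie_mul x (lie_mul y z) = lie_mul (lie_mul x y) z;
  lie_mul1g : forall x, lie_mul lie_one x = x;
  lie_mulVg : forall x, lie_mul (lie_inv x) x = lie_one;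
  lie_mul_smooth : smooth_map2 lie_mul;
  lie_inv_smooth : smooth_map lie_inv
}.

Section LieGroups.
Context {R : realType} (G : lieGroup R).

(* The Lie bracket plays no role below, only the Frechet space T_1 G does. *)
Definition lie_algebra : frechetType R := tangent (lie_one G).

Definition is_lie_subgroup (H : set G) : Prop :=
  [/\ H (lie_one G), (forall x y, H x -> H y -> H (lie_mul x y)),
      (forall x, H x -> H (lie_inv x)) & is_submanifold H].

Definition is_exponential (exp : lie_algebra -> G) : Prop :=
  [/\ smooth_map (exp : flat_manifold lie_algebra -> G),
      (forall (xi : lie_algebra) (s t : R),
         exp ((s + t) *: xi) = lie_mul (exp (s *: xi)) (exp (t *: xi))) &
      forall xi : lie_algebra, velocity (fun t => exp (t *: xi)) = xi].

(* Pairings are continuous; nondegeneracy is weak. *)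
Definition nondegenerate_pairing (kappa : lie_algebra -> lie_algebra -> R) :
    Prop :=
  [/\ bilinear_form kappa,
      (forall xi eta, kappa xi eta = kappa eta xi),
      continuous (fun z : lie_algebra * lie_algebra => kappa z.1 z.2 : R^o) &
      forall xi, (forall eta, kappa xi eta = 0) -> xi = 0].

Definition norm_squared (T : Type) (kappa : lie_algebra -> lie_algebra -> R)
    (J : T -> lie_algebra) (x : T) : R := kappa (J x) (J x).

Context {M : frechetManifold R} (act : G -> M -> M).

Definition smooth_left_action : Prop :=
  [/\ smooth_map2 act,
      (forall p, act (lie_one G) p = p) &
      forall g h p, act (lie_mul g h) p = act g (act h p)].

Definition symplectic_action
    (omega : forall p : M, tangent p -> tangent p -> R) : Prop :=
  forall g p (X Y : tangent p),
    omega (act g p) (tangent_map (act g) X) (tangent_map (act g) Y) =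
    omega p X Y.

Definition stabilizer (p : M) : set G := [set g | act g p = p].

Context (exp : lie_algebra -> G).

Definition fundamental_field (xi : lie_algebra) (p : M) : tangent p :=
  velocity (fun t => act (exp (t *: xi)) p).

Definition isotropy_algebra (p : M) : set lie_algebra :=
  [set xi | fundamental_field xi p = 0].

(* For sigma in the isotropy algebra of p, [act (exp (t *: sigma))] fixes p, so
   that t |-> T_p (act (exp (t *: sigma))) X is a curve in the Frechet space
   [tangent p]. *)
Definition isotropy_rep (p : M) (sigma : lie_algebra) (X : tangent p) :
    tangent p :=
  tvs_derive (fun t : R^o => tangent_map (act (exp (t *: sigma))) X : tangent p)
    0 1.

Definition is_momentum_map (omega : forall p : M, tangent p -> tangent p -> R)
    (kappa : lie_algebra -> lie_algebra -> R) (J : M -> lie_algebra) : Prop :=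
  smooth_map (J : M -> flat_manifold lie_algebra) /\
  forall p (X : tangent p) (xi : lie_algebra),
    omega p (fundamental_field xi p) X +
    kappa (@tangent_map _ M (flat_manifold lie_algebra) J p X) xi = 0.

Definition is_isotropy_momentum_map
    (omega : forall p : M, tangent p -> tangent p -> R)
    (kappa : lie_algebra -> lie_algebra -> R)
    (p : M) (Jhat : tangent p -> lie_algebra) : Prop :=
  forall X : tangent p, isotropy_algebra p (Jhat X) /\
    forall sigma, isotropy_algebra p sigma ->
      kappa (Jhat X) sigma = 2^-1 * omega p X (isotropy_rep sigma X).

End LieGroups.

(* Main.v *)
Require Import Defs.
From mathcomp Require Import all_boot all_order all_algebra.
From mathcomp Require Import all_classical all_reals all_analysis.
From mathcomp Require Import ring lra.

Set Implicit Arguments.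
Unset Strict Implicit.
Unset Printing Implicit Defensive.

Import Order.TTheory GRing.Theory Num.Theory.
Import numFieldNormedType.Exports.

Local Open Scope classical_set_scope.
Local Open Scope ring_scope.

(* In the chart at m put j = J in coordinates and s = coordinates of the
   fundamental field of sigma = J(m), so that s vanishes at m.  Along a curve x(t)
   through m the function f = |J|^2 has f'(t) = 2 kappa(j(x), (j o x)'), and
   f'(0) = 0 by criticality.  Hence f''(0)/2 is the limit of
     kappa((j(x(t)) - sigma) / t, (j o x)'(t)) + kappa(sigma, (j o x)'(t)) / t;
   the first term tends to kappa(TJ X, TJ X) and the second, by the momentum map
   equation, equals - omega_x(t)(s(x(t)) / t, x'(t)), which tends to
   - omega_m(Ds X, X) because s is differentiable and omega jointly continuous.  No
   second derivative of J or derivative of omega is needed.  Ds X is the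
   isotropy representation by symmetry of the second derivatives of the action in
   coordinates, and the polarized formula follows since it is omega-skew.

   The calculus of Michal-Bastiani smooth maps rests on a mean value theorem with
   values in convex sets, which in a locally convex space replaces the integral
   form and the Hahn-Banach theorem. *)

(** * Calculus in locally convex spaces *)

Section Calculus.
Context {R : realType}.

Definition convex (E : lmodType R) (C : set E) : Prop :=
  forall y z (t : R), 0 <= t -> t <= 1 -> C y -> C z ->
    C (t *: y + (1 - t) *: z).

Lemma nbhs_convex (E : tvsType R) (x : E) (A : set E) : nbhs x A ->
  exists C : set E, [/\ open C, C x, C `<=` A & convex C].
Proof.
move=> xA; have [B Bc [Bo Bb]] := @locally_convex R E.
have [C [BC Cx] CA] := Bb x A xA.
exists C; split => //; first exact: Bo.
move=> y z t t0 t1 Cy Cz.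
have := Bc _ (mem_set BC) y z (Itv01 t0 t1) (mem_set Cy) (mem_set Cz).
by move/set_mem.
Qed.

Lemma curve_is_deriveE (E : tvsType R) (y : R -> E) (t : R) (l : E) :
  tvs_is_derive (y : R^o -> E) t 1 l =
  ((fun h : R => h^-1 *: (y (h + t) - y t)) @ 0^' --> l).
Proof.
rewrite /tvs_is_derive.
suff -> : (fun h : R => h^-1 *: (y (h *: (1 : R^o) + t) - y t)) =
  (fun h : R => h^-1 *: (y (h + t) - y t)) by [].
by apply/funext => h; rewrite [h *: _]mulr1.
Qed.

Lemma class_C_is_derive k (E F : tvsType R) (U : set E) (f : E -> F) x v :
  class_C k.+1 U f -> U x -> tvs_is_derive f x v (tvs_derive f x v).
Proof. by case=> _ [df _] Ux; apply: xgetPex; exact: df. Qed.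

(** Mean value theorem with values in a convex set. As [C] is a neighbourhood of each derivative,
    short difference quotients based at any point lie in [C]. A quotient over two adjacent intervals
    is the convex combination, weighted by length, of the quotients over each. *)
Lemma convex_increment (F : tvsType R) (C : set F) (g : R -> F) : convex C ->
  (forall s, 0 <= s <= 1 ->
    exists2 l, tvs_is_derive (g : R^o -> F) s 1 l & nbhs l C) ->
  C (g 1 - g 0).
Proof.
move=> cC dg.
(* [P] is local and transitive, so the supremum of the b with [P 0 b] is 1. *)
pose P a b := C ((b - a)^-1 *: (g b - g a)).
have loc s : 0 <= s <= 1 -> exists2 d : R, 0 < d &
    forall h, h != 0 -> `|h| < d -> C (h^-1 *: (g (h + s) - g s)).
  move=> /dg[l]; rewrite curve_is_deriveE => gl lC.
  have /nbhs_ballP[d /= d0 dC] := gl _ lC.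
  exists d => // h h0 hd; apply: dC => //.
  by rewrite -ball_normE /= sub0r normrN.
have Ptrans a b c : a < b -> b < c -> P a b -> P b c -> P a c.
  move=> ab bc Pab Pbc; rewrite /P.
  have ab0 : 0 < b - a by rewrite subr_gt0.
  have bc0 : 0 < c - b by rewrite subr_gt0.
  have ac0 : 0 < c - a by lra.
  have := cC _ _ ((b - a) / (c - a)) _ _ Pab Pbc.
  rewrite !scalerA.
  have -> : (b - a) / (c - a) * (b - a)^-1 = (c - a)^-1 by field; lra.
  have -> : (1 - (b - a) / (c - a)) * (c - b)^-1 = (c - a)^-1 by field; lra.
  rewrite -scalerDr [X in _ *: X]addrC subrKA; apply.
  - by rewrite divr_ge0// ltW.
  - by rewrite ler_pdivrMr//; lra.
(* The guard [0 < b] is what puts 0 in [S]: as [0^-1 = 0], [P 0 0] reads [C 0], which may fail. *)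
pose S := [set b : R | 0 <= b <= 1 /\ (0 < b -> P 0 b)].
have S0 : S 0 by split; [rewrite lexx ler01 | rewrite ltxx].
have ubS : ubound S 1 by move=> b [/andP[]].
have supS : has_sup S by split; [exists 0 | exists 1].
pose b := sup S.
have b0 : 0 <= b by apply: ub_le_sup => //; exists 1.
have b1 : b <= 1 by apply: ge_sup => //; exists 0.
have [|d d0 Cd] := loc b; first exact/andP.
(* A difference quotient is unchanged when its endpoints are swapped, so [Cd] also covers the
   intervals ending at [b]. *)
have Pl a : b - d < a -> a < b -> P a b.
  move=> da ab; have := Cd (a - b); rewrite subrK.
  rewrite /P -[b - a]opprB invrN scaleNr -scalerN opprB; apply.
    by rewrite subr_eq0 lt_eqF.
  by rewrite ltr0_norm; lra.
have Pr a : b < a -> a < b + d -> P b a.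
  move=> ba ad; have := Cd (a - b); rewrite subrK; apply.
    by rewrite subr_eq0 gt_eqF.
  by rewrite gtr0_norm; lra.
have Pb : 0 < b -> P 0 b.
  move=> bp; have [a [/andP[a0 a1] Pa] ba] := sup_adherent d0 supS.
  have [ab|] := ltP a b; last first.
    move=> ba'; have ab : a <= b.
      by apply: ub_le_sup; [exists 1 | split; [exact/andP|]].
    have bE : b = a by apply/le_anti/andP.
    by rewrite bE; apply: Pa; rewrite -bE.
  have [a0'|] := ltP 0 a.
    by apply: (Ptrans 0 a b) => //; [exact: Pa | exact: Pl].
  move=> a0'; have aE : a = 0 by apply/le_anti/andP.
  by apply: Pl; rewrite -aE.
have [bl1|] := ltP b 1; last first.
  move=> bg1; have bE : b = 1 by apply/le_anti/andP.
  by have := Pb; rewrite bE /P subr0 invr1 scale1r; apply.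
(* If [b < 1], this point lies beyond [b], within the radius [d] and in [0, 1]; then [P 0 e]
   contradicts the choice of [b] as supremum. *)
pose e := Num.min 1 (b + d / 2).
have be : b < e by rewrite lt_min bl1/=; lra.
have ed : e < b + d by rewrite gt_min; apply/orP; right; lra.
have e1 : e <= 1 by rewrite ge_min lexx.
have Pe : P 0 e.
  have [bp|] := ltP 0 b; first by apply: (Ptrans 0 b e) => //; [exact: Pb|exact: Pr].
  move=> b0'; have bE : b = 0 by apply/le_anti/andP.
  by rewrite -bE; exact: Pr.
have : e <= b.
  by apply: ub_le_sup; [exists 1 | split => //; rewrite e1 andbT; lra].
by rewrite leNgt be.
Qed.

(** * Michal-Bastiani classes, strict differentiability and the chain rule *)

Lemma class_C_subset k (E F : tvsType R) (U V : set E) (f : E -> F) :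
  V `<=` U -> class_C k U f -> class_C k V f.
Proof.
elim: k E F U V f => [|k IH] E F U V f VU.
  by case=> cf _; split=> // x /VU; exact: cf.
case=> cf [df dfC]; split; first by move=> x /VU; exact: cf.
split; first by move=> x v /VU; exact: df.
by apply: IH dfC => -[x v] [/= /VU].
Qed.

Lemma class_CW k (E F : tvsType R) (U : set E) (f : E -> F) :
  class_C k.+1 U f -> class_C k U f.
Proof.
elim: k E F U f => [|k IH] E F U f; first by case.
case=> cf [df dfC]; split => //; split => //; exact: IH.
Qed.

(** Freezing the direction precomposes (x, v) |-> Df(x)v with the affine map x |-> (x, v), a case of
    [class_C_affine]. *)
Lemma class_C_derive k (E F : tvsType R) (U : set E) (f : E -> F) (v : E) :
  class_C k.+1 U f -> class_C k U (fun x => tvs_derive f x v).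
Proof.
case=> _ [_ dfC].
pose L (x : E) : E * E := (x, 0).
have linL : linear L.
  by move=> a x y; rewrite /L; congr pair; rewrite /= scaler0 addr0.
have cL : continuous L.
  by move=> x; apply: cvg_pair => /=; [exact: cvg_id | exact: cvg_cst].
have := class_C_affine (0, v) linL cL dfC.
have -> : [set z | (U `*` setT) (L z + (0, v))] = U.
  by apply/seteqP; split => x /=; rewrite addr0 //; case.
by under eq_fun do rewrite /= addr0 add0r.
Qed.

Lemma tvs_cvgD (T : Type) (F : set_system T) {FF : Filter F} (E : tvsType R)
    (f g : T -> E) (a b : E) :
  f @ F --> a -> g @ F --> b -> (fun x => f x + g x) @ F --> a + b.
Proof.
exact: (continuous2_cvg _ (@add_continuous E (a, b))).
Qed.

Lemma tvs_cvgZ (T : Type) (F : set_system T) {FF : Filter F} (E : tvsType R)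
    (k : T -> R^o) (f : T -> E) (c : R^o) (a : E) :
  k @ F --> c -> f @ F --> a -> (fun x => k x *: f x) @ F --> c *: a.
Proof.
exact: (@continuous2_cvg _ R^o E E _ _ _ _ (fun (r : R^o) (x : E) => r *: x)
  _ _ (@scale_continuous R E (c, a))).
Qed.

Lemma tvs_cvgN (T : Type) (F : set_system T) {FF : Filter F} (E : tvsType R)
    (f : T -> E) (a : E) :
  f @ F --> a -> (fun x => - f x) @ F --> - a.
Proof. by move=> fa; exact: (cvg_comp _ _ fa (@opp_continuous E a)). Qed.

Lemma tvs_cvgB (T : Type) (F : set_system T) {FF : Filter F} (E : tvsType R)
    (f g : T -> E) (a b : E) :
  f @ F --> a -> g @ F --> b -> (fun x => f x - g x) @ F --> a - b.
Proof. by move=> fa gb; apply: tvs_cvgD => //; exact: tvs_cvgN. Qed.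

Lemma add_scale_cvg (E : tvsType R) (x v : E) :
  (fun z : (E * E) * R^o => z.2 *: z.1.2 + z.1.1) @ (x, v, 0 : R^o) --> x.
Proof.
rewrite -[X in _ --> X]add0r -[X in _ --> X + _](scale0r v).
apply: tvs_cvgD; last exact: (cvg_comp _ _ cvg_fst cvg_fst).
by apply: tvs_cvgZ; [exact: cvg_snd | exact: (cvg_comp _ _ cvg_fst cvg_snd)].
Qed.

Lemma dnbhs0_mulr (a : R) : a != 0 -> (fun r : R => r * a) @ 0^' --> 0^'.
Proof.
move=> a0 B B0.
have : (fun r : R^o => r *: (a : R^o)) @ (0 : R^o) --> (0 : R^o) *: (a : R^o).
  exact: (@tvs_cvgZ _ _ _ R^o id (fun=> a) _ _ cvg_id (cvg_cst _)).
rewrite scale0r => ca.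
apply: (@filterS _ (nbhs (0 : R^o)) _ _ _ _ (ca _ B0)) => r /= Br r0; apply: Br.
by rewrite mulf_neq0.
Qed.

(** Strict differentiability: base point, direction and increment, stored in this order in [z], vary
    together. On a small segment the derivatives in the direction w stay in a convex neighbourhood
    of Df(x)v, by joint continuity of the derivative, and [convex_increment] passes this to the
    difference quotient. *)
Lemma class_C1_strict (E F : tvsType R) (U : set E) (f : E -> F) (x v : E)
    (A : set F) :
  open U -> class_C 1 U f -> U x -> nbhs (tvs_derive f x v) A ->
  \forall z \near (x, v, 0 : R^o), z.2 != 0 ->
    A (z.2^-1 *: (f (z.2 *: z.1.2 + z.1.1) - f z.1.1)).
Proof.
move=> oU fC Ux fA; have [_ [_ [cdf _]]] := fC.
have [C [oC Cx CA cC]] := nbhs_convex fA.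
have [[N1 N2] /= [xN1 vN2] NC] : nbhs (x, v)
    [set z : E * E | U z.1 /\ C (tvs_derive f z.1 z.2)].
  apply: filterI; first by apply: cvg_fst; exact: open_nbhs_nbhs.
  have /= := cdf (x, v) (conj Ux Logic.I) C; apply.
  exact: open_nbhs_nbhs.
have [N [oN Nx NN1 cN]] := nbhs_convex xN1.
have xN : nbhs x N by exact: open_nbhs_nbhs.
near=> z; move=> z0; apply: CA.
have Nz : N z.1.1.
  by near: z; apply: (cvg_comp _ _ cvg_fst cvg_fst).
have Nz' : N (z.2 *: z.1.2 + z.1.1) by near: z; exact: add_scale_cvg.
have N2z : N2 z.1.2 by near: z; apply: (cvg_comp _ _ cvg_fst cvg_snd).
move: z.1.1 z.1.2 z.2 z0 Nz Nz' N2z => y w h h0 Ny Ny' N2w.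
(* With the factor [h^-1] included, the derivative of [g] at s is exactly that of [f] in the
   direction w at the point s h w + y. *)
pose g (s : R) := h^-1 *: f (s *: (h *: w) + y).
have -> : h^-1 *: (f (h *: w + y) - f y) = g 1 - g 0.
  by rewrite /g scale1r scale0r add0r scalerBr.
apply: convex_increment => // s /andP[s0 s1].
have Ns : N (s *: (h *: w) + y).
  have := cN _ _ s s0 s1 Ny' Ny.
  by rewrite scalerDr -addrA -scalerDl addrCA subrr addr0 scale1r.
have [/= Us Cs] : [set z : E * E | U z.1 /\ C (tvs_derive f z.1 z.2)]
    (s *: (h *: w) + y, w).
  by apply: (NC (s *: (h *: w) + y, w)); split => //=; exact: NN1.
exists (tvs_derive f (s *: (h *: w) + y) w); last exact: open_nbhs_nbhs.
rewrite curve_is_deriveE.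
have -> : (fun r => r^-1 *: (g (r + s) - g s)) =
    (fun r => r^-1 *: (f (r *: w + (s *: (h *: w) + y)) -
      f (s *: (h *: w) + y))) \o (fun r : R => r * h).
  apply/funext => r; rewrite /g /= -scalerBr scalerA invfM.
  by rewrite !scalerA mulrDl scalerDl addrA.
apply: (@cvg_comp _ _ _ _ _ _ 0^'); last exact: class_C_is_derive fC Us.
exact: dnbhs0_mulr.
Unshelve. all: by end_near. Qed.

Lemma tvs_cvg_pair (T : Type) (F : set_system T) {FF : Filter F}
    (E E' : tvsType R) (f : T -> E) (g : T -> E') (a : E) (b : E') :
  f @ F --> a -> g @ F --> b -> (fun x => (f x, g x)) @ F --> (a, b).
Proof.
move=> fa gb.
exact: (@cvg_pair _ _ _ F (nbhs a) (nbhs b) _ _ _ f g fa gb).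
Qed.

Lemma dnbhs0_id : (fun h : R => h : R^o) @ 0^' --> (0 : R^o).
Proof. exact: cvg_within. Qed.

(** Write y(t + h) = y(t) + h w, where w is the difference quotient of y. Since w tends to v, the
    strict derivative of [f] with moving direction w gives the limit. *)
Lemma chain_curve (E F : tvsType R) (U : set E) (f : E -> F) (y : R -> E)
    (t : R) (v : E) :
  open U -> class_C 1 U f -> U (y t) -> tvs_is_derive (y : R^o -> E) t 1 v ->
  tvs_is_derive (f \o y : R^o -> F) t 1 (tvs_derive f (y t) v).
Proof.
move=> oU fC Uy; rewrite !curve_is_deriveE => yv A fA.
have fS := class_C1_strict oU fC Uy fA.
have qv : (fun h : R => ((y t, h^-1 *: (y (h + t) - y t)), h : R^o)) @ 0^' -->
    (y t, v, 0 : R^o).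
  apply: tvs_cvg_pair; last exact: dnbhs0_id.
  by apply: tvs_cvg_pair; [exact: cvg_cst | exact: yv].
have := qv _ fS; rewrite /= !near_simpl => qS.
near=> h.
have h0 : h != 0 by near: h; exact: nbhs_dnbhs_neq.
have : A (h^-1 *: (f (h *: (h^-1 *: (y (h + t) - y t)) + y t) - f (y t))).
  by move: h0; near: h; exact: qS.
by rewrite scalerA divff// scale1r subrK.
Unshelve. all: by end_near. Qed.

Lemma line_cvg (E : tvsType R) (x v : E) :
  (fun h : R => h *: v + x) @ 0^' --> x.
Proof.
have -> : (fun h : R => h *: v + x) =
    (fun z : (E * E) * R^o => z.2 *: z.1.2 + z.1.1) \o (fun h => (x, v, h)).
  by [].
apply: cvg_comp; last exact: add_scale_cvg.
by apply: tvs_cvg_pair; [exact: cvg_cst | exact: dnbhs0_id].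
Qed.

Lemma near_is_derive (E F : tvsType R) (f g : E -> F) (x v : E) (l : F) :
  (\forall y \near x, f y = g y) -> tvs_is_derive f x v l ->
  tvs_is_derive g x v l.
Proof.
move=> fg; rewrite /tvs_is_derive => fl.
apply: cvg_trans fl; apply: near_eq_cvg; near=> h.
rewrite -(nbhs_singleton fg); congr (_ *: (_ - _)).
by near: h; apply: (@line_cvg E x v _ fg).
Unshelve. all: by end_near. Qed.

Lemma derive_cvg_line (E F : tvsType R) (f : E -> F) (x v : E) (l : F) :
  tvs_is_derive f x v l -> (fun h : R => f (h *: v + x)) @ 0^' --> f x.
Proof.
move=> fl.
have H : (fun h : R => (h : R^o) *: (h^-1 *: (f (h *: v + x) - f x)) + f x) @ 0^'
    --> (0 : R^o) *: l + f x.
  apply: tvs_cvgD; last exact: cvg_cst.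
  by apply: tvs_cvgZ; [exact: cvg_within | exact: fl].
move: H; rewrite scale0r add0r; apply: cvg_trans; apply: near_eq_cvg; near=> h.
have h0 : h != 0 by near: h; exact: nbhs_dnbhs_neq.
by rewrite scalerA divff// scale1r subrK.
Unshelve. all: by end_near. Qed.

Lemma curve_derive_cvg (E : tvsType R) (y : R -> E) (t : R) (l : E) :
  tvs_is_derive (y : R^o -> E) t 1 l -> (fun h => y (h + t)) @ 0^' --> y t.
Proof.
move=> /derive_cvg_line.
suff -> : (fun h : R => y (h *: (1 : R^o) + t)) = (fun h => y (h + t)) by [].
by apply/funext => h; rewrite [h *: _]mulr1.
Qed.

Lemma is_derive_scale (E F : tvsType R) (f : E -> F) (x v : E) (l : F) (a : R) :
  tvs_is_derive f x v l -> tvs_is_derive f x (a *: v) (a *: l).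
Proof.
(* For [a != 0] the claim is the substitution of [h * a] for [h], which keeps h away from 0. *)
move=> fl; have [->|a0] := eqVneq a 0.
  rewrite !scale0r /tvs_is_derive; apply: cvg_near_cst; near=> h.
  by rewrite scaler0 add0r subrr scaler0.
rewrite /tvs_is_derive.
have : (fun h : R => (a : R^o) *: ((h * a)^-1 *: (f ((h * a) *: v + x) - f x))) @ 0^'
    --> (a : R^o) *: l.
  apply: tvs_cvgZ; first exact: cvg_cst.
  exact: (cvg_comp _ _ (dnbhs0_mulr a0) fl).
apply: cvg_trans; apply: near_eq_cvg; near=> h.
have h0 : h != 0 by near: h; exact: nbhs_dnbhs_neq.
by rewrite !scalerA invfM mulrCA divff// mulr1.
Unshelve. all: by end_near. Qed.

(** Homogeneity is [is_derive_scale]. For additivity, go from x to x + h v and from there along u';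
    strict differentiability allows the second increment to start at the moving point x + h v. *)
Lemma tvs_derive_linear (E : tvsType R) (F : frechetType R) (U : set E)
    (f : E -> F) (x : E) :
  open U -> class_C 1 U f -> U x -> linear (tvs_derive f x).
Proof.
move=> oU fC Ux a u v; apply: tvs_derive_val.
have fv := class_C_is_derive (v := v) fC Ux.
have fu := is_derive_scale (a := a) (class_C_is_derive (v := u) fC Ux).
rewrite -(tvs_derive_val fu).
set u' := a *: u.
have fu' : (fun h : R => h^-1 *: (f (h *: u' + (h *: v + x)) - f (h *: v + x)))
    @ 0^' --> tvs_derive f x u'.
  move=> A fA.
  have qv : (fun h : R => ((h *: v + x, u'), h : R^o)) @ 0^' --> (x, u', 0 : R^o).
    apply: tvs_cvg_pair; last exact: dnbhs0_id.
    by apply: tvs_cvg_pair; [exact: line_cvg | exact: cvg_cst].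
  have := qv _ (class_C1_strict oU fC Ux fA); rewrite /= !near_simpl => qS.
  near=> h.
  have h0 : h != 0 by near: h; exact: nbhs_dnbhs_neq.
  by move: h0; near: h; exact: qS.
move: fv; rewrite /tvs_is_derive => fv.
apply: cvg_trans (tvs_cvgD fu' fv); apply: near_eq_cvg; near=> h.
have -> : h *: (u' + v) + x = h *: u' + (h *: v + x) by rewrite scalerDr addrA.
by rewrite -scalerDr addrA subrK.
Unshelve. all: by end_near. Qed.

Lemma frechet_inseparable_eq (F : frechetType R) (a b : F) :
  (forall A B, nbhs a A -> nbhs b B -> A `&` B !=set0) -> a = b.
Proof. by move=> ab; apply: (@frechet_hausdorff R F) => A B; exact: ab. Qed.

(** Applied to s |-> y(t s), [convex_increment] puts y(t) - y(0) in every convex neighbourhood of 0,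
    and the space is Hausdorff. *)
Lemma zero_derive_const (F : frechetType R) (y : R -> F) (e : R) :
  (forall t, `|t| < e -> tvs_is_derive (y : R^o -> F) t 1 0) ->
  forall t, `|t| < e -> y t = y 0.
Proof.
move=> dy t te; apply/eqP; rewrite -subr_eq0; apply/eqP/esym.
apply: frechet_inseparable_eq => A B A0 Bt; exists (y t - y 0); split; last first.
  exact: nbhs_singleton.
have [C [oC C0 CA cC]] := nbhs_convex A0; apply: CA.
have := @convex_increment F C (fun s => y (t * s)) cC; rewrite mulr1 mulr0.
apply => s /andP[s0 s1]; exists 0; last exact: open_nbhs_nbhs.
have ts : `|t * s| < e.
  by rewrite normrM (ger0_norm s0); apply: le_lt_trans te; rewrite ler_piMr.
have := is_derive_scale (a := t) (dy _ ts); rewrite scaler0.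
rewrite curve_is_deriveE /tvs_is_derive.
suff -> : (fun h : R => h^-1 *: (y (h *: (t *: (1 : R^o)) + t * s) - y (t * s))) =
    (fun h : R => h^-1 *: (y (t * (h + s)) - y (t * s))) by [].
by apply/funext => h; rewrite [_ *: 1]mulr1 [h *: _]mulrC mulrDr.
Qed.

(** * Bilinear forms and symmetry of second derivatives *)

Section Scalar.
Context {E : lmodType R} (f : E -> R) (fs : scalar f).

Lemma scalarform0 : f 0 = 0.
Proof. by have := fs (-1) 0 0; rewrite scaler0 addr0 mulN1r addNr. Qed.

Lemma scalarformZ a x : f (a *: x) = a * f x.
Proof. by have := fs a x 0; rewrite !addr0 scalarform0 addr0. Qed.

Lemma scalarformD x y : f (x + y) = f x + f y.
Proof. by have := fs 1 x y; rewrite scale1r mul1r. Qed.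

Lemma scalarformB x y : f (x - y) = f x - f y.
Proof. by rewrite scalarformD -scaleN1r scalarformZ mulN1r. Qed.

End Scalar.

Lemma cvg_form (E : tvsType R) (b : E -> E -> R) (T : Type) (F : set_system T)
    {FF : Filter F} (f g : T -> E) (x y : E) :
  {for (x, y), continuous (fun z : E * E => b z.1 z.2 : R^o)} ->
  f @ F --> x -> g @ F --> y ->
  (fun t => b (f t) (g t) : R^o) @ F --> (b x y : R^o).
Proof. by move=> cb fx gy; exact: (cvg_comp _ _ (tvs_cvg_pair fx gy) cb). Qed.

(** Product rule: the increment splits into one of p, paired with q(t + h), and one of q, paired
    with p(t). Joint continuity of [b] gives both limits. *)
Lemma bilinear_is_derive (E : tvsType R) (b : E -> E -> R) (p q : R -> E) (t : R)
    (p' q' : E) :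
  bilinear_form b -> continuous (fun z : E * E => b z.1 z.2 : R^o) ->
  tvs_is_derive (p : R^o -> E) t 1 p' -> tvs_is_derive (q : R^o -> E) t 1 q' ->
  tvs_is_derive (fun s : R^o => b (p s) (q s) : R^o) t 1
    (b p' (q t) + b (p t) q' : R^o).
Proof.
move=> [bl br] cb pp qq.
have qt := curve_derive_cvg qq.
move: pp qq; rewrite !curve_is_deriveE => pp qq.
have pt : (fun=> p t) @ (0 : R)^' --> p t by exact: cvg_cst.
have h1 : (fun h => b (h^-1 *: (p (h + t) - p t)) (q (h + t)) : R^o) @ 0^'
    --> (b p' (q t) : R^o) by exact: cvg_form (cb (p', q t)) pp qt.
have h2 : (fun h => b (p t) (h^-1 *: (q (h + t) - q t)) : R^o) @ 0^'
    --> (b (p t) q' : R^o) by exact: cvg_form (cb (p t, q')) pt qq.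
apply: cvg_trans (@tvs_cvgD _ _ _ R^o _ _ _ _ h1 h2).
apply: near_eq_cvg; near=> h => /=.
rewrite (scalarformZ (bl _)) (scalarformZ (br _)) (scalarformB (bl _)).
by rewrite (scalarformB (br _)) -mulrDr addrA subrK.
Unshelve. all: by end_near. Qed.

(** The mean value theorem in the direction v reduces the second difference to difference quotients
    of g = D_v f in the direction u, taken at base points near x. Strict differentiability of g
    controls these. *)
Lemma second_difference (E F : tvsType R) (U : set E) (f : E -> F) (x u v : E)
    (A : set F) :
  open U -> class_C 2 U f -> U x ->
  nbhs (tvs_derive (fun z => tvs_derive f z v) x u) A ->
  \forall z \near (0 : R^o, 0 : R^o), z.1 != 0 -> z.2 != 0 ->
    A ((z.1 * z.2)^-1 *: (f (z.1 *: u + z.2 *: v + x) - f (z.1 *: u + x)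
      - f (z.2 *: v + x) + f x)).
Proof.
move=> oU fC Ux fA.
have f1 : class_C 1 U f by exact: class_CW.
pose g z := tvs_derive f z v.
have gC : class_C 1 U g by exact: class_C_derive.
have [C [oC Cx CA cC]] := nbhs_convex fA.
have gS := class_C1_strict oU gC Ux (open_nbhs_nbhs (conj oC Cx)).
have [[Q1 Q2] /= [Q1x Q20] QC] := gS.
have [[P1 P2] /= [P1x P2u] PQ] := Q1x.
(* Convexity of [N] keeps the segments in the direction v, to which the mean value theorem is
   applied, inside [U] and [P1]. *)
have [N [oN Nx NP cN]] : exists N : set E,
    [/\ open N, N x, N `<=` U `&` P1 & convex N].
  by apply: nbhs_convex; apply: filterI => //; exact: open_nbhs_nbhs.
have nN : nbhs x N by exact: open_nbhs_nbhs.
have cN' (w : E) : (fun z : R^o => z *: w + x) @ (0 : R^o) --> x.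
  rewrite -[X in _ --> X]add0r -[X in _ --> X + _](scale0r w).
  apply: tvs_cvgD; last exact: cvg_cst.
  by apply: tvs_cvgZ; [exact: cvg_id | exact: cvg_cst].
have cN2 : (fun z : R^o * R^o => z.1 *: u + z.2 *: v + x) @ (0 : R^o, 0 : R^o) --> x.
  rewrite -[X in _ --> X]add0r -[X in _ --> X + _]addr0.
  rewrite -[X in _ --> X + _ + _](scale0r u) -[X in _ --> _ + X + _](scale0r v).
  apply: tvs_cvgD; last exact: cvg_cst.
  apply: tvs_cvgD.
    by apply: tvs_cvgZ; [exact: cvg_fst | exact: cvg_cst].
  by apply: tvs_cvgZ; [exact: cvg_snd | exact: cvg_cst].
near=> z; move=> h0 t0; apply: CA.
have Nh : N (z.1 *: u + x).
  by near: z; apply: (cvg_comp _ _ cvg_fst (cN' u)).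
have Nt : N (z.2 *: v + x).
  by near: z; apply: (cvg_comp _ _ cvg_snd (cN' v)).
have Nht : N (z.1 *: u + z.2 *: v + x) by near: z; exact: cN2.
have Q2h : Q2 z.1 by near: z; exact: cvg_fst.
move: z.1 z.2 h0 t0 Nh Nt Nht Q2h => h t h0 t0 Nh Nt Nht Q2h.
pose G (s : R) := (h * t)^-1 *:
  (f ((s * t) *: v + (h *: u + x)) - f ((s * t) *: v + x)).
have zE1 (a b c d : F) : a - b - c + d = a - c - (b - d).
  by rewrite opprB addrA [RHS]addrAC; congr (_ + _); rewrite addrAC.
have zE2 (a b c d : F) : (a - b) - (c - d) = (a - c) - (b - d).
  by rewrite !opprD !opprK addrACA.
have -> : (h * t)^-1 *: (f (h *: u + t *: v + x) - f (h *: u + x)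
      - f (t *: v + x) + f x) = G 1 - G 0.
  rewrite /G mul1r mul0r scale0r !add0r -scalerBr; congr (_ *: _).
  have -> : h *: u + t *: v + x = t *: v + (h *: u + x).
    by rewrite addrA [t *: v + _]addrC.
  exact: zE1.
have Ns s (y : E) : 0 <= s -> s <= 1 -> N y -> N (t *: v + y) ->
    N ((s * t) *: v + y).
  move=> s0 s1 Ny Nty; have := cN _ _ s s0 s1 Nty Ny.
  by rewrite scalerDr scalerA -addrA -scalerDl addrCA subrr addr0 scale1r.
apply: convex_increment => // s /andP[s0 s1].
have N1 : N ((s * t) *: v + x) by exact: Ns.
have N2 : N ((s * t) *: v + (h *: u + x)).
  by apply: Ns => //; rewrite addrA [t *: v + _]addrC.
(* The derivative of [G] at s: the factor t from the chain rule cancels against [(h * t)^-1],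
   leaving a difference quotient of [g] with increment h u. *)
exists (h^-1 *: (g ((s * t) *: v + (h *: u + x)) - g ((s * t) *: v + x))).
  have df y : N y -> tvs_is_derive f y v (g y).
    by move=> /NP[Uy _]; exact: class_C_is_derive f1 Uy.
  have cv y : N ((s * t) *: v + y) ->
      (fun r : R => r^-1 *: (f (((r + s) * t) *: v + y) - f ((s * t) *: v + y)))
      @ 0^' --> t *: g ((s * t) *: v + y).
    move=> Ny; have := is_derive_scale (a := t) (df _ Ny); rewrite /tvs_is_derive.
    apply: cvg_trans; apply: near_eq_cvg; near=> r.
    by rewrite mulrDl scalerDl addrA scalerA.
  rewrite curve_is_deriveE.
  have cst : (fun=> (h * t)^-1 : R^o) @ (0 : R)^' --> ((h * t)^-1 : R^o).
    exact: cvg_cst.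
  have -> (a b : F) : h^-1 *: (a - b) = (h * t)^-1 *: (t *: a - t *: b).
    by rewrite -scalerBr scalerA invfM -mulrA mulVf// mulr1.
  apply: cvg_trans (tvs_cvgZ cst (tvs_cvgB (cv _ N2) (cv _ N1))).
  apply: near_eq_cvg; near=> r.
  rewrite /G -!scalerBr zE2 [RHS]scalerA [_ / (h * t)]mulrC.
  by rewrite -[RHS]scalerA.
apply: open_nbhs_nbhs; split => //.
have /= := QC (((s * t) *: v + x, u), h); rewrite addrCA; apply => //.
split => //=; apply: PQ; split => /=; last exact: nbhs_singleton.
by have [] := NP _ N1.
Unshelve. all: by end_near. Qed.

(** With equal increments the second difference is symmetric in u and v. It therefore lies
    eventually in any neighbourhood of either mixed derivative, and Hausdorff separation forces the
    two to agree. *)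
Lemma class_C2_symmetric (E : tvsType R) (F : frechetType R) (U : set E)
    (f : E -> F) (x u v : E) :
  open U -> class_C 2 U f -> U x ->
  tvs_derive (fun z => tvs_derive f z v) x u =
  tvs_derive (fun z => tvs_derive f z u) x v.
Proof.
move=> oU fC Ux; apply: frechet_inseparable_eq => A B uA vB.
have sA := second_difference oU fC Ux uA.
have sB := second_difference oU fC Ux vB.
have H : \forall h \near (0 : R)^', (A `&` B) ((h * h)^-1 *:
    (f (h *: u + h *: v + x) - f (h *: u + x) - f (h *: v + x) + f x)).
  have d2 : (fun h : R => (h : R^o, h : R^o)) @ 0^' --> (0 : R^o, 0 : R^o).
    by apply: tvs_cvg_pair; exact: dnbhs0_id.
  have := d2 _ sA; have := d2 _ sB; rewrite /= !near_simpl => qB qA.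
  near=> h.
  have h0 : h != 0 by near: h; exact: nbhs_dnbhs_neq.
  split; first by move: (h0) (h0); near: h; exact: qA.
  have : B ((h * h)^-1 *:
    (f (h *: v + h *: u + x) - f (h *: v + x) - f (h *: u + x) + f x)).
    by move: (h0) (h0); near: h; exact: qB.
  by rewrite [h *: v + h *: u]addrC [f _ - f _ - f _]addrAC.
have [h Hh] := filter_ex H.
by eexists; exact: Hh.
Unshelve. all: by end_near. Qed.

Lemma line_is_deriveE (E F : tvsType R) (f : E -> F) (x v : E) (l : F) :
  tvs_is_derive (fun h : R^o => f (h *: v + x)) 0 1 l = tvs_is_derive f x v l.
Proof.
rewrite (@curve_is_deriveE _ (fun h => f (h *: v + x))) /tvs_is_derive.
suff -> : (fun h : R => h^-1 *: (f ((h + 0) *: v + x) - f (0 *: v + x))) =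
    (fun h : R => h^-1 *: (f (h *: v + x) - f x)) by [].
by apply/funext => h; rewrite addr0 scale0r add0r.
Qed.

Lemma chain_is_derive (E F H : tvsType R) (U : set F) (f : F -> H) (g : E -> F)
    (x v : E) (l : F) :
  open U -> class_C 1 U f -> U (g x) -> tvs_is_derive g x v l ->
  tvs_is_derive (f \o g) x v (tvs_derive f (g x) l).
Proof.
rewrite -(line_is_deriveE g) -(line_is_deriveE (f \o g)) => oU fC Ux gl.
have := @chain_curve _ _ U f (fun h => g (h *: v + x)) 0 l oU fC.
by rewrite scale0r add0r; apply.
Qed.

Lemma pair_is_derive (E F F' : tvsType R) (f : E -> F) (g : E -> F') (x v : E)
    (l : F) (l' : F') :
  tvs_is_derive f x v l -> tvs_is_derive g x v l' ->
  tvs_is_derive (fun z => (f z, g z)) x v (l, l').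
Proof. by move=> fl gl; exact: tvs_cvg_pair fl gl. Qed.

Lemma cst_is_derive (E F : tvsType R) (a : F) (x v : E) :
  tvs_is_derive (fun=> a) x v 0.
Proof.
rewrite /tvs_is_derive; apply: cvg_near_cst; near=> h.
by rewrite subrr scaler0.
Unshelve. all: by end_near. Qed.

Lemma id_is_derive (E : tvsType R) (x v : E) : tvs_is_derive id x v v.
Proof. exact: linear_is_derive. Qed.

End Calculus.

(** * Charts *)

Section ChartLemmas.
Context {R : realType} {M : frechetManifold R}.
Implicit Types c d : chart M (model M).

Lemma chart_invK c x : chart_cod c x -> c (chart_inv c x) = x.
Proof. by case=> q qc <-; rewrite chart_mapK. Qed.

Lemma chart_inv_dom c x : chart_cod c x -> chart_dom c (chart_inv c x).
Proof. by case=> q qc <-; rewrite chart_mapK. Qed.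

Lemma chart_cod_map c p : chart_dom c p -> chart_cod c (c p).
Proof. by exists p. Qed.

Lemma nbhs_chart_cod c x : chart_cod c x -> nbhs x (chart_cod c).
Proof. by move=> cx; apply: open_nbhs_nbhs; split => //; exact: chart_cod_open. Qed.

Lemma nbhs_chart_dom c p : chart_dom c p -> nbhs p (chart_dom c).
Proof. by move=> cp; apply: open_nbhs_nbhs; split => //; exact: chart_dom_open. Qed.

Lemma transition_domE c d :
  c @` (chart_dom c `&` chart_dom d) =
  [set x | chart_cod c x /\ chart_dom d (chart_inv c x)].
Proof.
apply/seteqP; split => [_ [p [cp dp] <-]|x [cx dx]].
  by split; [exact: chart_cod_map | rewrite /= chart_mapK].
exists (chart_inv c x); last exact: chart_invK.
by split => //; exact: chart_inv_dom.
Qed.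

Lemma chart_vector_is_derive c x v : atlas c -> chart_cod c x ->
  tvs_is_derive (chart_at (chart_inv c x) \o chart_inv c) x v
    (chart_vector c x v).
Proof.
move=> cA cx; have [_ dC] := atlas_smooth cA (chart_at_atlas (chart_inv c x)).
apply: (class_C_is_derive (dC 1%N)).
by rewrite transition_domE; split => //; exact: chart_at_dom.
Qed.

Lemma chart_vector_linear c x : atlas c -> chart_cod c x ->
  linear (chart_vector c x : model M -> model M).
Proof.
move=> cA cx; have [oV dC] := atlas_smooth cA (chart_at_atlas (chart_inv c x)).
apply: (tvs_derive_linear oV (dC 1%N)).
by rewrite transition_domE; split => //; exact: chart_at_dom.
Qed.

Lemma chart_vector_at (m : M) v :
  chart_vector (chart_at m) (chart_at m m) v = v :> model M.
Proof.
rewrite /chart_vector chart_mapK; last exact: chart_at_dom.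
apply: tvs_derive_val; apply: (@near_is_derive _ _ _ id); last exact: id_is_derive.
have := nbhs_chart_cod (chart_cod_map (chart_at_dom m)).
by apply: filterS => y cy /=; rewrite chart_invK.
Qed.

Lemma smooth_to_flat_chart (F : frechetType R) (f : M -> F) c k :
  smooth_map (f : M -> flat_manifold F) -> atlas c ->
  class_C k (chart_cod c) (f \o chart_inv c).
Proof.
move=> [_ _ fC] cA; have [_ /(_ k)] := fC c (id_chart F) cA erefl.
by apply: class_C_subset => x cx.
Qed.

(** [tangent_map] is computed in the preferred chart at the point; the chain rule through the
    transition from [c] gives it in any chart of the atlas. *)
Lemma tangent_map_chart (F : frechetType R) (f : M -> F) c x v :
  smooth_map (f : M -> flat_manifold F) -> atlas c -> chart_cod c x ->
  @tangent_map _ M (flat_manifold F) f (chart_inv c x) (chart_vector c x v) =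
  tvs_derive (f \o chart_inv c) x v.
Proof.
move=> fS cA cx; set p := chart_inv c x; pose d := chart_at p.
have fC := smooth_to_flat_chart 1 fS (chart_at_atlas p).
have pd : chart_dom d p by exact: chart_at_dom.
have dv := chart_vector_is_derive (v := v) cA cx.
have := chain_is_derive (chart_cod_open d) fC (chart_cod_map pd) dv.
move=> H; apply/esym/tvs_derive_val; apply: near_is_derive H.
have [oV _] := atlas_smooth cA (chart_at_atlas p).
have : nbhs x (c @` (chart_dom c `&` chart_dom d)).
  by apply: open_nbhs_nbhs; split => //; rewrite transition_domE.
by apply: filterS => y; rewrite transition_domE => -[cy dy] /=; rewrite chart_mapK.
Qed.

(** As for [tangent_map_chart]: the transition to the preferred chart at [gamma 0] carries the
    coordinate velocity in [c] to [velocity gamma]. *)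
Lemma velocity_chart c (gamma : R -> M) (l : model M) :
  atlas c -> (\forall t \near (0 : R), chart_dom c (gamma t)) ->
  tvs_is_derive (c \o gamma : R^o -> model M) 0 1 l ->
  velocity gamma = tvs_derive (chart_at (gamma 0) \o chart_inv c) (c (gamma 0)) l
    :> model M.
Proof.
move=> cA cg gl; have g0 := nbhs_singleton cg.
have [oV dC] := atlas_smooth cA (chart_at_atlas (gamma 0)).
apply: tvs_derive_val => /=.
have V0 : (c @` (chart_dom c `&` chart_dom (chart_at (gamma 0)))) (c (gamma 0)).
  by exists (gamma 0) => //; split => //; exact: chart_at_dom.
apply: near_is_derive (chain_is_derive oV (dC 1%N) V0 gl).
by apply: filterS cg => t ct /=; rewrite chart_mapK.
Qed.

End ChartLemmas.

(** * The action and the isotropy representation in a chart *)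

Section ActionInChart.
Context {R : realType} {M : frechetManifold R} {G : lieGroup R}.
Context (act : G -> M -> M) (act_action : smooth_left_action act).
Context (exp : lie_algebra G -> G) (exp_exponential : is_exponential exp).

Implicit Types (c : chart M (model M)) (sigma : lie_algebra G) (p : M).

Let e : chart G (model G) := chart_at (lie_one G).

(** The same chart [c] serves source and target: group elements close to the identity keep a given
    point of [c] inside its domain. *)
Definition act_chart (c : chart M (model M)) (z : model G * model M) : model M :=
  c (act (chart_inv e z.1) (chart_inv c z.2)).

Definition act_chart_dom (c : chart M (model M)) : set (model G * model M) :=
  [set z | [/\ chart_cod e z.1, chart_cod c z.2 &
    chart_dom c (act (chart_inv e z.1) (chart_inv c z.2))]].

Definition exp_chart (sigma : lie_algebra G) (t : R) : model G :=
  e (exp (t *: sigma)).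

Definition exp_velocity (sigma : lie_algebra G) : model G :=
  tvs_derive (exp_chart sigma : R^o -> model G) 0 1.

(* The coordinates of the fundamental field.  Written as a partial derivative of
   the action, its smoothness in x needs no composition rule for [class_C]. *)
Definition field_chart (c : chart M (model M)) (sigma : lie_algebra G)
    (x : model M) : model M :=
  tvs_derive (act_chart c) (exp_chart sigma 0, x) (exp_velocity sigma, 0).

(** Meant for exp(0), which the one-parameter group law makes idempotent. *)
Lemma lie_idem1 (g : G) : lie_mul g g = g -> g = lie_one G.
Proof.
move=> gg; have := congr1 (lie_mul (lie_inv g)) gg.
by rewrite lie_mulA lie_mulVg lie_mul1g.
Qed.

Lemma exponential0 sigma : exp (0 *: sigma) = lie_one G.
Proof.
have [_ expD _] := exp_exponential.
by apply: lie_idem1; rewrite -expD addr0.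
Qed.

Lemma act_exponential0 sigma p : act (exp (0 *: sigma)) p = p.
Proof. by rewrite exponential0; have [_ ->] := act_action. Qed.

Lemma one_dom : chart_dom e (lie_one G).
Proof. exact: chart_at_dom. Qed.

Lemma exp_ray_continuous sigma : continuous (fun t : R^o => exp (t *: sigma)).
Proof.
have [[_ expC _] _ _] := exp_exponential.
move=> t; apply: (@continuous_comp _ _ _ (fun t : R^o => t *: sigma) exp).
  exact: scale_vector_continuous.
exact: (expC (t *: sigma) Logic.I).
Qed.

Lemma exp_ray_near sigma : \forall t \near (0 : R), chart_dom e (exp (t *: sigma)).
Proof.
have := @exp_ray_continuous sigma (0 : R^o) (chart_dom e); apply.
by rewrite exponential0; exact: nbhs_chart_dom one_dom.
Qed.

Lemma orbit_continuous sigma p :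
  continuous (fun t : R^o => act (exp (t *: sigma)) p).
Proof.
have [[actC _] _ _] := act_action => t.
apply: (@continuous_comp _ _ _ (fun t : R^o => (exp (t *: sigma), p))
  (fun z : G * M => act z.1 z.2)); last exact: actC.
have := @cvg_pair _ _ _ _ _ _ _ _ _ (fun t : R^o => exp (t *: sigma)) (fun=> p)
  (@exp_ray_continuous sigma t) (cvg_cst p).
exact.
Qed.

Lemma orbit_near sigma c p : chart_dom c p ->
  \forall t \near (0 : R), chart_dom c (act (exp (t *: sigma)) p).
Proof.
move=> cp; have := @orbit_continuous sigma p (0 : R^o) (chart_dom c); apply.
by rewrite act_exponential0; exact: nbhs_chart_dom cp.
Qed.

Lemma act_chart_exp c sigma t x : chart_dom e (exp (t *: sigma)) ->
  act_chart c (exp_chart sigma t, x) =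
  c (act (exp (t *: sigma)) (chart_inv c x)).
Proof. by move=> et; rewrite /act_chart /exp_chart /= chart_mapK. Qed.

Lemma act_chart_dom_exp c sigma t x : chart_dom e (exp (t *: sigma)) ->
  chart_cod c x -> chart_dom c (act (exp (t *: sigma)) (chart_inv c x)) ->
  act_chart_dom c (exp_chart sigma t, x).
Proof.
move=> et cx cgx; split => //=; first exact: chart_cod_map.
by rewrite /exp_chart chart_mapK.
Qed.

Lemma act_chart_dom0 c sigma x : chart_cod c x ->
  act_chart_dom c (exp_chart sigma 0, x).
Proof.
move=> cx; apply: act_chart_dom_exp => //.
  by rewrite exponential0; exact: one_dom.
by rewrite act_exponential0; exact: chart_inv_dom.
Qed.

Lemma act_chart_smooth c : atlas c -> smooth_on (act_chart_dom c) (act_chart c).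
Proof.
have [[_ aC] _ _] := act_action.
by move=> cA; exact: (aC e c c (chart_at_atlas _) cA cA).
Qed.

Lemma exp_chart_is_derive sigma :
  tvs_is_derive (exp_chart sigma : R^o -> model G) 0 1 (exp_velocity sigma).
Proof.
have [[_ _ eC] _ _] := exp_exponential.
have [_ /(_ 1%N) eC1] := eC (id_chart _) e erefl (chart_at_atlas _).
pose L (t : R^o) : lie_algebra G := t *: sigma.
have linL : linear L by move=> a s t; rewrite /L scalerDl scalerA.
have cL : continuous L by exact: scale_vector_continuous.
have aC := class_C_affine 0 linL cL eC1.
have expE : exp_chart sigma =
    (fun t => (e \o exp \o chart_inv (id_chart (lie_algebra G))) (L t + 0)).
  by apply/funext => t; rewrite /= addr0.
rewrite /exp_velocity expE.
apply: class_C_is_derive aC _ => /=; rewrite addr0; split => //.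
  by exists (L 0).
by rewrite /L exponential0; exact: one_dom.
Qed.

(** Chain rule along t |-> ([exp_chart sigma t], x), whose velocity at 0 is ([exp_velocity sigma],
    0). *)
Lemma field_chart_is_derive c sigma x : atlas c -> chart_cod c x ->
  tvs_is_derive (fun t : R^o => c (act (exp (t *: sigma)) (chart_inv c x))) 0 1
    (field_chart c sigma x).
Proof.
move=> cA cx; have [oA /(_ 1%N) AC] := act_chart_smooth cA.
have H := pair_is_derive (@exp_chart_is_derive sigma)
  (@cst_is_derive _ R^o _ x 0 1).
apply: near_is_derive (chain_is_derive oA AC (act_chart_dom0 sigma cx) H).
have := exp_ray_near sigma; apply: filterS => t et /=.
exact: act_chart_exp.
Qed.

Lemma field_chartE c sigma x : atlas c -> chart_cod c x ->
  fundamental_field act exp sigma (chart_inv c x) =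
  chart_vector c x (field_chart c sigma x) :> model M.
Proof.
move=> cA cx; rewrite /fundamental_field.
rewrite (velocity_chart cA (@orbit_near sigma c _ (chart_inv_dom cx))
  (@field_chart_is_derive c sigma x cA cx)).
by rewrite act_exponential0 chart_invK.
Qed.

(** The action is C^2 in coordinates. Fixing the direction and then the group variable in its
    derivative leaves a C^1 map of x, both being affine precompositions. *)
Lemma field_chart_class_C c sigma : atlas c ->
  class_C 1 (chart_cod c) (field_chart c sigma).
Proof.
move=> cA; have [_ /(_ 2%N) AC] := act_chart_smooth cA.
have DC := class_C_derive (exp_velocity sigma, 0) AC.
pose L (x : model M) : model G * model M := (0, x).
have linL : linear L.
  by move=> a x y; rewrite /L; congr pair; rewrite /= scaler0 addr0.
have cL : continuous L.
  by move=> x; apply: tvs_cvg_pair; [exact: cvg_cst | exact: cvg_id].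
have LE x : L x + (exp_chart sigma 0, 0) = (exp_chart sigma 0, x).
  by rewrite /L; congr pair; rewrite /= ?add0r ?addr0.
have := class_C_affine (exp_chart sigma 0, 0) linL cL DC.
rewrite (_ : (fun z => _) = field_chart c sigma); last first.
  by apply/funext => x; rewrite LE.
apply: class_C_subset => x cx /=; rewrite LE; exact: act_chart_dom0.
Qed.

End ActionInChart.

(** * The isotropy representation as linearized fundamental field *)

Section Isotropy.
Context {R : realType} {M : frechetManifold R} {G : lieGroup R}.
Context (act : G -> M -> M) (act_action : smooth_left_action act).
Context (exp : lie_algebra G -> G) (exp_exponential : is_exponential exp).
Context (m : M) (sigma : lie_algebra G).
Context (sigma_isotropy : isotropy_algebra act exp m sigma).

Let c := chart_at m.
Let x0 : model M := c m.
Let cA : atlas c := chart_at_atlas m.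
Let cm : chart_dom c m := chart_at_dom m.
Let cx0 : chart_cod c x0 := chart_cod_map cm.
Let A := act_chart act c.
Let a := exp_chart exp sigma.

Lemma field_chart_isotropy : field_chart act exp c sigma x0 = 0.
Proof.
have := field_chartE act_action exp_exponential sigma cA cx0.
by rewrite chart_vector_at chart_mapK// => <-.
Qed.

(* The orbit of m has velocity 0 at time t, since exp(t sigma) maps its germ at
   time 0, where the velocity is sigma . m = 0, to its germ at time t. *)
Lemma isotropy_fixes_near :
  \forall t \near (0 : R), act (exp (t *: sigma)) m = m.
Proof.
have et := exp_ray_near exp_exponential sigma.
have gt := orbit_near act_action exp_exponential sigma cm.
have /nbhs_ballP[r /= r0 rt] : \forall t \near (0 : R),
    chart_dom (chart_at (lie_one G)) (exp (t *: sigma)) /\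
    chart_dom c (act (exp (t *: sigma)) m) by exact: filterI.
pose y (t : R) : model M := c (act (exp (t *: sigma)) m).
have rt' t : `|t| < r -> chart_dom (chart_at (lie_one G)) (exp (t *: sigma)) /\
    chart_dom c (act (exp (t *: sigma)) m).
  by move=> tr; apply: rt; rewrite -ball_normE /= sub0r normrN.
have y0 : tvs_is_derive (y : R^o -> model M) 0 1 0.
  have := field_chart_is_derive act_action exp_exponential (sigma := sigma) cA cx0.
  by rewrite field_chart_isotropy chart_mapK.
have yc : forall t, `|t| < r -> tvs_is_derive (y : R^o -> model M) t 1 0.
  move=> t tr; have [etr gtr] := rt' t tr.
  have [oA /(_ 1%N) AC] := act_chart_smooth act_action cA.
  have yx0 : y 0 = x0 by rewrite /y act_exponential0.
  have At : act_chart_dom act c (a t, y 0).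
    by rewrite yx0; apply: act_chart_dom_exp; rewrite // chart_mapK.
  (* For small h the group law gives y(t + h) = A(a(t), y(h)). The right side has derivative 0 at h
     = 0, because y'(0) = 0 and the derivative of A is linear. *)
  have := chain_is_derive oA AC At
    (pair_is_derive (@cst_is_derive _ R^o _ (a t) 0 1) y0).
  have -> : tvs_derive (act_chart act c) (a t, y 0) (0, 0) = 0.
    have := tvs_derive_linear oA AC At (-1) 0 0.
    by rewrite !scaleN1r !oppr0 !addr0 addNr.
  rewrite !curve_is_deriveE; apply: cvg_trans; apply: near_eq_cvg; near=> h.
  rewrite addr0; congr (_ *: (_ - _)); last first.
    rewrite /= act_chart_exp// yx0 chart_mapK//.
  rewrite /= act_chart_exp//.
  have gh : chart_dom c (act (exp (h *: sigma)) m).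
    by near: h; apply: nbhs_dnbhs; exact: gt.
  rewrite /y chart_mapK//.
  have [_ expD _] := exp_exponential; have [_ _ actM] := act_action.
  by rewrite [h + t]addrC expD actM.
near=> t.
have tr : `|t| < r.
  near: t; apply/nbhs_ballP; exists r => //= t.
  by rewrite -ball_normE /= sub0r normrN.
have := zero_derive_const yc tr; rewrite /y act_exponential0// => yE.
have [_ gtr] := rt' t tr.
by rewrite -[LHS](chart_mapK gtr) yE chart_mapK.
Unshelve. all: by end_near. Qed.

(** For small t the image of m is m itself, so [tangent_map] uses the chart at m on both sides and
    becomes the partial derivative of the action in x. *)
Lemma tangent_map_isotropy (X : tangent m) : \forall t \near (0 : R),
  tangent_map (act (exp (t *: sigma))) X = tvs_derive A (a t, x0) (0, X)
    :> model M.
Proof.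
have et := exp_ray_near exp_exponential sigma.
near=> t.
rewrite /tangent_map.
have -> : act (exp (t *: sigma)) m = m by near: t; exact: isotropy_fixes_near.
rewrite /tvs_derive; congr (xget _ _); apply/seteqP.
suff E : (fun h : R => h^-1 *: ((chart_at m \o act (exp (t *: sigma)) \o
      chart_inv (chart_at m)) (h *: X + chart_at m m) -
      (chart_at m \o act (exp (t *: sigma)) \o
      chart_inv (chart_at m)) (chart_at m m))) =
    (fun h : R => h^-1 *: (A (h *: (0, X) + (a t, x0)) - A (a t, x0))).
  by split => l; rewrite /tvs_is_derive /= E.
have etr : chart_dom (chart_at (lie_one G)) (exp (t *: sigma)).
  by near: t; exact: et.
apply/funext => h.
have -> : h *: (0, X) + (a t, x0) = (a t, h *: X + x0) :> model G * model M.
  by congr pair; rewrite /= scaler0 add0r.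
by rewrite /A !act_chart_exp.
Unshelve. all: by end_near. Qed.

Lemma tangent_map_isotropy0 (X : tangent m) :
  tangent_map (act (exp (0 *: sigma))) X = X :> model M.
Proof.
rewrite /tangent_map act_exponential0//; apply: tvs_derive_val.
apply: (@near_is_derive _ _ _ id); last exact: id_is_derive.
apply: filterS (nbhs_chart_cod cx0) => x cx /=.
by rewrite act_exponential0// chart_invK.
Qed.

(** The left curve is, near 0, the derivative of A along (0, X) at (a(t), x0); its t-derivative is a
    mixed second derivative of A. Exchanging the two directions turns it into the derivative along X
    of [field_chart], itself the derivative of A along the exponential ray. *)
Lemma tangent_map_isotropy_is_derive (X : tangent m) :
  tvs_is_derive (fun t : R^o => tangent_map (act (exp (t *: sigma))) X : model M)
    0 1 (tvs_derive (field_chart act exp c sigma) x0 X).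
Proof.
have [oA AC] := act_chart_smooth act_action cA.
have A0 := act_chart_dom0 act_action exp_exponential sigma cx0.
have BC := class_C_derive (0, X) (AC 2%N).
have H := chain_is_derive oA BC A0
  (pair_is_derive (exp_chart_is_derive exp_exponential (sigma := sigma))
     (@cst_is_derive _ R^o _ x0 0 1)).
have -> : tvs_derive (field_chart act exp c sigma) x0 X =
    tvs_derive (fun z => tvs_derive A z (0, X)) (a 0, x0)
      (exp_velocity exp sigma, 0).
  rewrite (class_C2_symmetric _ _ oA (AC 2%N) A0).
  have fC := field_chart_class_C act_action exp_exponential sigma cA.
  apply: tvs_derive_val.
  have := class_C_is_derive (v := (0, X))
    (class_C_derive (exp_velocity exp sigma, 0) (AC 2%N)) A0.
  rewrite -line_is_deriveE -[X in _ -> X]line_is_deriveE.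
  have -> // : (fun h : R^o => field_chart act exp c sigma (h *: X + x0)) =
    (fun h : R^o => tvs_derive A (h *: (0, X) + (a 0, x0))
      (exp_velocity exp sigma, 0)).
  apply/funext => h; rewrite /field_chart -/a.
  have -> // : h *: (0, X) + (a 0, x0) = (a 0, h *: X + x0) :> model G * model M.
  by congr pair; rewrite /= scaler0 add0r.
apply: near_is_derive H.
by apply: filterS (tangent_map_isotropy X) => t ->.
Unshelve. all: by end_near. Qed.

Lemma isotropy_repE (X : tangent m) :
  isotropy_rep act exp sigma X = tvs_derive (field_chart act exp c sigma) x0 X
    :> model M.
Proof. by apply: tvs_derive_val; exact: tangent_map_isotropy_is_derive. Qed.

Lemma isotropy_rep_linear :
  linear (@isotropy_rep _ _ _ act exp m sigma : model M -> model M).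
Proof.
move=> k X Y; rewrite !isotropy_repE.
have fC := field_chart_class_C act_action exp_exponential sigma cA.
exact: (tvs_derive_linear (chart_cod_open c) fC cx0).
Qed.

End Isotropy.

(** * The Hessian *)

Section FormInChart.
Context {R : realType} {M : frechetManifold R}.
Context (omega : forall p : M, tangent p -> tangent p -> R).
Context (omega_symplectic : symplectic_form omega).
Implicit Types c : chart M (model M).

Lemma form_in_chart_bilinear c x : atlas c -> chart_cod c x ->
  bilinear_form (form_in_chart omega c x).
Proof.
move=> cA cx; have cvL := chart_vector_linear cA cx.
have [_ /(_ (chart_inv c x)) [ol or] _ _ _] := omega_symplectic.
split=> [v|u] k y z; rewrite /form_in_chart cvL; [exact: ol | exact: or].
Qed.

Lemma form_in_chart_cvg c x u v (T : Type) (F : set_system T) {FF : Filter F}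
    (y f g : T -> model M) :
  atlas c -> chart_cod c x -> y @ F --> x -> f @ F --> u -> g @ F --> v ->
  (fun t => form_in_chart omega c (y t) (f t) (g t) : R^o) @ F -->
  (form_in_chart omega c x u v : R^o).
Proof.
move=> cA cx yx fu gv; have [oS _ _ _ _] := omega_symplectic.
have [_ /(_ 0%N)[cS _]] := oS c cA.
have cw := cS ((x, u), v) (conj (conj cx Logic.I) Logic.I).
exact: (cvg_comp _ _ (tvs_cvg_pair (tvs_cvg_pair yx fu) gv) cw).
Qed.

Lemma form_in_chart_at (m : M) (u v : tangent m) :
  form_in_chart omega (chart_at m) (chart_at m m) u v = omega u v.
Proof.
(* Every tangent space is [model M] by conversion, so the base point of [omega] can be changed along
   q = m without a cast. *)
have omegaE q (U V : model M) : q = m -> @omega q U V = @omega m U V.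
  by move=> ->.
rewrite /form_in_chart (omegaE _ _ _ (chart_mapK (chart_at_dom m))).
by rewrite !chart_vector_at.
Qed.

Lemma symplectic_antisymmetric (m : M) (u v : tangent m) : omega u v = - omega v u.
Proof.
have [_ /(_ m)[ol or] oalt _ _] := omega_symplectic.
have := oalt m (u + v).
rewrite (scalarformD (ol _)) !(scalarformD (or _)) !oalt add0r addr0.
by move/eqP; rewrite addr_eq0 => /eqP.
Qed.

Lemma form_continuous (m : M) :
  continuous (fun z : tangent m * tangent m => omega z.1 z.2 : R^o).
Proof.
have -> : (fun z : tangent m * tangent m => omega z.1 z.2 : R^o) =
    (fun z => form_in_chart omega (chart_at m) (chart_at m m) z.1 z.2).
  by apply/funext => z; rewrite form_in_chart_at.
move=> z.
exact: (@form_in_chart_cvg _ (chart_at m m) z.1 z.2 _ _ _ (fun=> chart_at m m)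
  fst snd (chart_at_atlas m) (chart_cod_map (chart_at_dom m))
  (cvg_cst _) cvg_fst cvg_snd).
Qed.

End FormInChart.

Lemma is_derive_real (R : realType) (f : R -> R) (t l : R) :
  tvs_is_derive (f : R^o -> R^o) t 1 l ->
  is_derive (t : R^o) (1 : R^o) (f : R^o -> R^o) l.
Proof.
move=> fl; apply: DeriveDef; first by apply/cvg_ex; exists l; exact: fl.
exact: (cvg_lim (@real_hausdorff R) fl).
Qed.

Lemma derive1_real (R : realType) (f : R -> R) (t l : R) :
  tvs_is_derive (f : R^o -> R^o) t 1 l -> derive1 (f : R -> R^o) t = l.
Proof. by move=> /is_derive_real[_ fl]; rewrite derive1E. Qed.

(** * The Hessian of the squared norm of the momentum map *)

Section Hessian.
Context {R : realType} {M : frechetManifold R} {G : lieGroup R}.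
Context (omega : forall p : M, tangent p -> tangent p -> R).
Context (omega_symplectic : symplectic_form omega).
Context (act : G -> M -> M) (act_action : smooth_left_action act).
Context (exp : lie_algebra G -> G) (exp_exponential : is_exponential exp).
Context (kappa : lie_algebra G -> lie_algebra G -> R).
Context (kappa_pairing : nondegenerate_pairing kappa).
Context (J : M -> lie_algebra G).
Context (J_momentum : is_momentum_map act exp omega kappa J).

Lemma pairingC xi eta : kappa xi eta = kappa eta xi.
Proof. by have [] := kappa_pairing. Qed.

Lemma pairing_bilinear : bilinear_form kappa.
Proof. by have [] := kappa_pairing. Qed.

Lemma pairing_continuous :
  continuous (fun z : lie_algebra G * lie_algebra G => kappa z.1 z.2 : R^o).
Proof. by have [] := kappa_pairing. Qed.

(** The momentum map equation at every point of the chart, so that it can be used along a curve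
    leaving m. *)
Lemma momentum_in_chart (c : chart M (model M)) x xi v :
  atlas c -> chart_cod c x ->
  kappa (tvs_derive (J \o chart_inv c) x v) xi =
  - form_in_chart omega c x (field_chart act exp c xi x) v.
Proof.
move=> cA cx; have [JS JM] := J_momentum.
have := JM (chart_inv c x) (chart_vector c x v) xi.
rewrite tangent_map_chart// /form_in_chart.
rewrite -(field_chartE act_action exp_exponential xi cA cx).
by move/eqP; rewrite addrC addr_eq0 => /eqP.
Qed.

Context (m : M).
Let c := chart_at m.
Let x0 : model M := c m.
Let cA : atlas c := chart_at_atlas m.
Let cm : chart_dom c m := chart_at_dom m.
Let cx0 : chart_cod c x0 := chart_cod_map cm.
Let j : model M -> lie_algebra G := J \o chart_inv c.

Let TJ (X : tangent m) : lie_algebra G :=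
  @tangent_map R M (flat_manifold (lie_algebra G)) J m X.

Lemma momentum_class_C k : class_C k (chart_cod c) j.
Proof. by have [JS _] := J_momentum; exact: smooth_to_flat_chart. Qed.

Lemma tangent_momentum_linear : linear TJ.
Proof.
by apply: (tvs_derive_linear (chart_cod_open c) (momentum_class_C 1)).
Qed.

Context (m_critical : critical_point (norm_squared kappa J) m).

(** By the product rule and symmetry of [kappa], the derivative of |J|^2 at m along X is twice the
    left side. *)
Lemma critical_orthogonal X : kappa (J m) (TJ X) = 0.
Proof.
have jX : tvs_is_derive (fun h : R^o => j (h *: (X : model M) + x0)) 0 1 (TJ X).
  by rewrite line_is_deriveE; apply: (class_C_is_derive (momentum_class_C 1)).
have := bilinear_is_derive pairing_bilinear pairing_continuous jX jX.
rewrite (line_is_deriveE (fun x => kappa (j x) (j x) : R^o)) => kX.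
(* The chart of [real_line] is the identity, so [m_critical X] is by conversion the vanishing of the
   derivative of kappa(j, j) along X. *)
have := etrans (esym (tvs_derive_val kX)) (m_critical X).
rewrite scale0r add0r /j /= chart_mapK// pairingC => /eqP.
by rewrite -mulr2n mulrn_eq0 => /eqP.
Qed.

(** The momentum map equation turns [critical_orthogonal] into omega(J(m) . m, X) = 0 for all X;
    nondegeneracy of [omega] concludes. *)
Lemma critical_isotropy : isotropy_algebra act exp m (J m).
Proof.
have [_ JM] := J_momentum; have [_ _ _ _ nd] := omega_symplectic.
apply: nd => X; have := JM m X (J m); rewrite pairingC.
by rewrite -/(TJ X) critical_orthogonal addr0.
Qed.

Lemma norm_squared_hessian :
  is_hessian (norm_squared kappa J) (fun X : tangent m =>
    2 * (kappa (TJ X) (TJ X) + omega X (isotropy_rep act exp (J m) X))).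
Proof.
move=> X gamma [U U0 [oU gC gS]] gm gX.
pose s := field_chart act exp c (J m).
pose xc (t : R) : model M := c (gamma t).
pose V : set R^o := [set t | U t /\ chart_dom c (gamma t)].
have [oV xC] : smooth_on V (xc : R^o -> model M).
  have [oW WC] := gS (id_chart R^o) c erefl cA.
  have WV : V = [set t : R^o | [/\ chart_cod (id_chart R^o) t,
      U (chart_inv (id_chart R^o) t) &
      chart_dom c (gamma (chart_inv (id_chart R^o) t))]].
    by apply/seteqP; split => t /= [] //; split => //; exists t.
  by rewrite WV; split => //; exact: WC.
have V0 : V 0 by split => //; rewrite gm; exact: cm.
have nV : nbhs (0 : R^o) V by exact: open_nbhs_nbhs.
pose x' (t : R) := tvs_derive (xc : R^o -> model M) t 1.
have xcx' t : V t -> tvs_is_derive (xc : R^o -> model M) t 1 (x' t).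
  by move=> Vt; exact: class_C_is_derive (xC 1%N) Vt.
have xc0 : xc 0 = x0 by rewrite /xc gm.
have x'0 : x' 0 = X.
  by rewrite -gX /velocity /tangent_map gm.
have codV t : V t -> chart_cod c (xc t).
  by case=> _ ct; exact: chart_cod_map.
pose a (t : R) := J (gamma t).
(* The velocity of [a] in the form Dj(x)x': [momentum_in_chart] applies to it, and its continuity at
   0 follows from that of (x, v) |-> Dj(x)v. *)
pose b (t : R) := tvs_derive j (xc t) (x' t).
have ab t : V t -> tvs_is_derive (a : R^o -> lie_algebra G) t 1 (b t).
  move=> Vt; have := chain_curve (chart_cod_open c) (momentum_class_C 1)
    (codV t Vt) (xcx' t Vt).
  apply: near_is_derive; have : nbhs (t : R^o) V by exact: open_nbhs_nbhs.
  by apply: filterS => r [_ cr]; rewrite /j /xc /= chart_mapK.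
have F' t : V t -> tvs_is_derive ((norm_squared kappa J \o gamma) : R^o -> R^o)
    t 1 (2 * kappa (a t) (b t) : R^o).
  move=> Vt.
  have := bilinear_is_derive pairing_bilinear pairing_continuous (ab t Vt) (ab t Vt).
  have -> : 2 * kappa (a t) (b t) = kappa (b t) (a t) + kappa (a t) (b t).
    by rewrite (pairingC (b t)) mulr_natl mulr2n.
  exact.
have a0 : a 0 = J m by rewrite /a gm.
have b0 : b 0 = TJ X by rewrite /b xc0 x'0.
split; first by apply: filterS nV => t /F' /is_derive_real[].
apply: is_derive_real.
apply: (@near_is_derive _ _ _ (fun t => 2 * kappa (a t) (b t) : R^o)).
  by apply: filterS nV => t /F' /derive1_real ->.
rewrite curve_is_deriveE.
have cxc : (fun h : R => xc h) @ 0^' --> x0.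
  rewrite -xc0; have := curve_derive_cvg (xcx' 0 V0).
  by under eq_fun do rewrite addr0.
have cx' : (fun h : R => x' h) @ 0^' --> (X : model M).
  rewrite -x'0; have [x'C _] := class_C_derive (1 : R^o) (xC 1%N).
  exact: (cvg_comp _ _ dnbhs0_id (x'C 0 V0)).
have cb : (fun h : R => b h) @ 0^' --> TJ X.
  have [_ [_ [DC _]]] := momentum_class_C 1.
  have := DC (x0, X) (conj cx0 Logic.I).
  exact: (cvg_comp _ _ (tvs_cvg_pair cxc cx')).
have ca : (fun h : R => h^-1 *: (a h - a 0)) @ 0^' --> TJ X.
  have := ab 0 V0; rewrite curve_is_deriveE b0.
  by under eq_fun do rewrite addr0.
have s0 : s x0 = 0.
  exact: field_chart_isotropy critical_isotropy.
(* As s(x0) = 0, the quotient s(x(h)) / h is a difference quotient, whose limit the chain rule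
   gives. *)
have cs : (fun h : R => h^-1 *: s (xc h)) @ 0^' --> tvs_derive s x0 X.
  have sC : class_C 1 (chart_cod c) s by exact: field_chart_class_C.
  have := chain_curve (chart_cod_open c) sC (codV 0 V0) (xcx' 0 V0).
  rewrite curve_is_deriveE xc0 x'0.
  by under eq_fun do rewrite /= addr0 xc0 s0 subr0.
have k1 : (fun h => kappa (h^-1 *: (a h - a 0)) (b h) : R^o) @ 0^' -->
    (kappa (TJ X) (TJ X) : R^o).
  exact: cvg_form (@pairing_continuous (TJ X, TJ X)) ca cb.
have k2 : (fun h => form_in_chart omega c (xc h) (h^-1 *: s (xc h)) (x' h) : R^o)
    @ 0^' --> (form_in_chart omega c x0 (tvs_derive s x0 X) X : R^o).
  exact: form_in_chart_cvg.
have -> : 2 * (kappa (TJ X) (TJ X) + omega X (isotropy_rep act exp (J m) X)) =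
    (2 : R^o) *: ((kappa (TJ X) (TJ X) : R^o) -
     (form_in_chart omega c x0 (tvs_derive s x0 X) X : R^o)).
  rewrite form_in_chart_at.
  rewrite -(isotropy_repE act_action exp_exponential critical_isotropy).
  by rewrite (symplectic_antisymmetric omega_symplectic X).
have c2 : (fun=> (2 : R^o)) @ (0 : R)^' --> (2 : R^o) by exact: cvg_cst.
apply: cvg_trans (tvs_cvgZ c2 (tvs_cvgB k1 k2)).
apply: near_eq_cvg; near=> h.
have Vh : V h by near: h; exact: nbhs_dnbhs nV.
have [kl kr] := pairing_bilinear.
have [fl fr] := form_in_chart_bilinear omega_symplectic cA (codV h Vh).
rewrite (scalarformZ (fl _)) (scalarformZ (kl _)) (scalarformB (kl _)).
(* This is the part of kappa(a(h), b(h)) missing from the first limit, where a(h) is replaced by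
   a(h) - J(m). *)
have -> : form_in_chart omega c (xc h) (s (xc h)) (x' h) = - kappa (J m) (b h).
  by rewrite pairingC /b momentum_in_chart ?opprK//; exact: codV.
(* The derivative of the squared norm vanishes at 0, so its difference quotient is just 2
   kappa(a(h), b(h)) / h. *)
rewrite addr0 a0 b0 critical_orthogonal mulr0 subr0 /=.
rewrite mulrN opprK -mulrDr subrK.
by rewrite [LHS]mulrCA.
Unshelve. all: by end_near. Qed.

End Hessian.

(** For small t, exp(t sigma) fixes m and its tangent map preserves omega_m. Differentiating
    omega(T_t X, T_t Y) = omega(X, Y) at t = 0 gives the infinitesimal identity. *)
Lemma isotropy_rep_skew (R : realType) (M : frechetManifold R) (G : lieGroup R)
    (omega : forall p : M, tangent p -> tangent p -> R) (act : G -> M -> M)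
    (exp : lie_algebra G -> G) (m : M) (sigma : lie_algebra G) :
  symplectic_form omega -> smooth_left_action act ->
  symplectic_action act omega -> is_exponential exp ->
  isotropy_algebra act exp m sigma ->
  forall X Y : tangent m,
    omega m (isotropy_rep act exp sigma X) Y =
    - omega m X (isotropy_rep act exp sigma Y).
Proof.
move=> omega_symplectic act_action act_symplectic exp_exponential sm X Y.
have T_derive Z := tangent_map_isotropy_is_derive act_action exp_exponential sm Z.
have [_ ob _ _ _] := omega_symplectic.
pose T (Z : tangent m) (t : R) : model M :=
  tangent_map (act (exp (t *: sigma))) Z.
have T0 Z : T Z 0 = Z by exact: (tangent_map_isotropy0 act_action exp_exponential).
have omegaE q (U V : model M) : q = m -> omega q U V = omega m U V.
  by move=> ->.
have near_cst : \forall t \near (0 : R^o), omega m (T X t) (T Y t) = omega m X Y.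
  have := isotropy_fixes_near act_action exp_exponential sm.
  by apply: filterS => t tm; rewrite -(omegaE _ _ _ tm) act_symplectic.
have H := @bilinear_is_derive R (model M) (omega m) (T X) (T Y) 0 _ _ (ob m)
  (@form_continuous _ _ _ omega_symplectic m) (T_derive X) (T_derive Y).
have := @tvs_derive_val R R^o R^o _ _ _ _ (near_is_derive near_cst H).
rewrite (@tvs_derive_val R R^o R^o _ _ _ _
  (@cst_is_derive _ R^o R^o (omega m X Y) 0 1)).
rewrite !T0 -!(isotropy_repE act_action exp_exponential sm).
by move/esym/eqP; rewrite addr_eq0 => /eqP.
Qed.

Theorem proposition4p8 (R : realType)
    (M : frechetManifold R) (M_connected : connected [set: M])
    (omega : forall p : M, tangent p -> tangent p -> R)
    (omega_symplectic : symplectic_form omega)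
    (G : lieGroup R) (act : G -> M -> M)
    (act_action : smooth_left_action act)
    (act_symplectic : symplectic_action act omega)
    (exp : lie_algebra G -> G) (exp_exponential : is_exponential exp)
    (kappa : lie_algebra G -> lie_algebra G -> R)
    (kappa_pairing : nondegenerate_pairing kappa)
    (J : M -> lie_algebra G) (J_momentum : is_momentum_map act exp omega kappa J)
    (m : M) (m_critical : critical_point (norm_squared kappa J) m)
    (stabilizer_lie : is_lie_subgroup (stabilizer act m))
    (Jhat : tangent m -> lie_algebra G)
    (Jhat_momentum : is_isotropy_momentum_map act exp omega kappa Jhat) :
  let TJ : tangent m -> lie_algebra G :=
    @tangent_map R M (flat_manifold (lie_algebra G)) J m in
  exists Hess : tangent m -> R,
    [/\ is_hessian (norm_squared kappa J) Hess,
        forall X : tangent m,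
          2^-1 * Hess X = kappa (TJ X) (TJ X) + 2 * kappa (Jhat X) (J m) &
        forall X Y : tangent m,
          2^-1 * polarization Hess X Y =
          kappa (TJ X) (TJ Y) + omega m X (isotropy_rep act exp (J m) Y)].
Proof.
move=> TJ.
have Jm : isotropy_algebra act exp m (J m).
  exact: (critical_isotropy omega_symplectic kappa_pairing J_momentum m_critical).
pose rep X : model M := isotropy_rep act exp (J m) (X : tangent m).
exists (fun X => 2 * (kappa (TJ X) (TJ X) + omega m X (rep X))); split.
- exact: (norm_squared_hessian omega_symplectic act_action exp_exponential
    kappa_pairing J_momentum m_critical).
(* J(m) lies in the isotropy algebra, so the defining equation of [Jhat] may be taken at sigma =
   J(m). *)
- move=> X; have [_ /(_ _ Jm) ->] := Jhat_momentum X.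
  by rewrite /rep; field.
- move=> X Y; rewrite /polarization.
  have TJD : TJ (X + Y) = TJ X + TJ Y.
    by have := tangent_momentum_linear J_momentum (m := m) 1 X Y; rewrite !scale1r.
  have repD : rep (X + Y) = rep X + rep Y.
    have := isotropy_rep_linear act_action exp_exponential Jm 1 X Y.
    by rewrite !scale1r.
  have [kl kr] := pairing_bilinear kappa_pairing.
  have [_ /(_ m)[ol or] _ _ _] := omega_symplectic.
  rewrite TJD repD !(scalarformD (kl _)) !(scalarformD (kr _)).
  rewrite !(scalarformD (ol _)) !(scalarformD (or _)).
  rewrite (pairingC kappa_pairing (TJ Y) (TJ X)).
  (* The two cross terms agree: omega(Y, rep X) = - omega(rep X, Y) = omega(X, rep Y). *)
  rewrite (@symplectic_antisymmetric _ _ _ omega_symplectic m Y (rep X)).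
  rewrite isotropy_rep_skew// opprK.
  (* Here p, q, r are the values of [kappa] on the pairs (X, X), (X, Y), (Y, Y) through [TJ], and s,
     t, u those of [omega] with [rep] in the second argument. *)
  have polarize (p q r s t u : R) :
      2^-1 * (2^-1 * (2 * (p + q + (q + r) + (s + t + (t + u))) -
        2 * (p + s) - 2 * (r + u))) = q + t by field.
  exact: polarize.
Qed.
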